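(* Let $(A,\cdot_A,a_A)$ be a left-symmetric algebroid over $M$ and let $n\ge1$. If $\omega\in\mathrm{Der}^n(A)$, then $\mathrm{d}_{def}\omega\in\mathrm{Der}^{n+1}(A)$, and its symbol is given by $$\begin{aligned}\sigma_{\mathrm{d}_{def}\omega}(x_1,\dots,x_n)=&\sum_{i=1}^n(-1)^{i+1}[a_A(x_i),\sigma_\omega(x_1,\dots,\hat{x_i},\dots,x_n)]_{\mathfrak X(M)}\\&+\sum_{1\le i<j\le n}(-1)^{i+j}\sigma_\omega([x_i,x_j]_A,x_1,\dots,\hat{x_i},\dots,\hat{x_j},\dots,x_n)\\&+\sum_{i=1}^n(-1)^{i+1}a_A\big(\omega(x_1,\dots,\hat{x_i},\dots,x_n,x_i)\big)\end{aligned}$$ for all $x_1,\dots,x_n\in\Gamma(A)$. Furthermore, $\mathrm{d}_{def}^2=0$. Thus $\big(\bigoplus_{n\ge1}\mathrm{Der}^n(A),\mathrm{d}_{def}\big)$ is a cochain complex.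
   Context: A left-symmetric algebra is a vector space with a bilinear product $\cdot$ such that $(x\cdot y)\cdot z-x\cdot(y\cdot z)=(y\cdot x)\cdot z-y\cdot(x\cdot z)$. A left-symmetric algebroid $(A,\cdot_A,a_A)$ is a vector bundle $A\to M$ with an ($\mathbb{R}$-bilinear) left-symmetric algebra structure $\cdot_A$ on $\Gamma(A)$ and a bundle map $a_A:A\to TM$ such that $x\cdot_A(fy)=f(x\cdot_A y)+a_A(x)(f)y$ and $(fx)\cdot_A y=f(x\cdot_A y)$ for $f\in C^\infty(M)$, $x,y\in\Gamma(A)$. Write $[x,y]_A=x\cdot_Ay-y\cdot_Ax$; $[\cdot,\cdot]_{\mathfrak X(M)}$ is the Lie bracket of vector fields. $\mathrm{Der}^n(A)$ ($n\ge1$), the space of multiderivations of degree $n$, consists of all $D\in\mathrm{Hom}_{\mathbb R}(\Lambda^{n-1}\Gamma(A)\otimes\Gamma(A),\Gamma(A))$ such that for all $f\in C^\infty(M)$ and $x_1,\dots,x_n\in\Gamma(A)$: $D$ is $C^\infty(M)$-linear in each of its first $n-1$ arguments, and $D(x_1,\dots,x_{n-1},fx_n)=fD(x_1,\dots,x_n)+\sigma_D(x_1,\dots,x_{n-1})(f)x_n$ for some $\sigma_D\in\Gamma(\mathrm{Hom}(\Lambda^{n-1}A,TM))$, called the symbol of $D$. For $\omega\in\mathrm{Der}^n(A)$ and $x_1,\dots,x_{n+1}\in\Gamma(A)$, define $$\begin{aligned}\mathrm{d}_{def}\omega(x_1,\dots,x_{n+1})=&\sum_{i=1}^n(-1)^{i+1}x_i\cdot_A\omega(x_1,\dots,\hat{x_i},\dots,x_{n+1})+\sum_{i=1}^n(-1)^{i+1}\omega(x_1,\dots,\hat{x_i},\dots,x_n,x_i)\cdot_Ax_{n+1}\\&-\sum_{i=1}^n(-1)^{i+1}\omega(x_1,\dots,\hat{x_i},\dots,x_n,x_i\cdot_Ax_{n+1})+\sum_{1\le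 i<j\le n}(-1)^{i+j}\omega([x_i,x_j]_A,x_1,\dots,\hat{x_i},\dots,\hat{x_j},\dots,x_{n+1}).\end{aligned}$$ *)

(* Defs.v *)
From HB Require Import structures.
From mathcomp Require Import all_boot all_order all_algebra.
From mathcomp Require Import all_classical all_reals.
From mathcomp Require Import topology normedtype landau derive.
From mathcomp Require Import ring.

Set Implicit Arguments.
Unset Strict Implicit.
Unset Printing Implicit Defensive.

Import Order.TTheory GRing.Theory Num.Theory.
Import numFieldNormedType.Exports.

Local Open Scope classical_set_scope.
Local Open Scope ring_scope.

(** * Smooth maps on open subsets of a normed space *)

(* n-fold (Frechet) differentiability; in finite dimension, differentiability
   of x |-> 'd f x is differentiability of x |-> 'd f x v for every v. *)
Fixpoint ndiff (R : realType) (V W : normedModType R) (n : nat) (U : set V)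
    (f : V -> W) : Prop :=
  if n is n'.+1 then
    (forall x, U x -> differentiable f x) /\
    (forall v, ndiff n' U (fun x => 'd f x v))
  else True.

Definition smooth_on (R : realType) (V W : normedModType R) (U : set V)
    (f : V -> W) : Prop :=
  forall n, ndiff n U f.

Section smooth_on_theory.
Variables (R : realType) (V : normedModType R).

Lemma near_eq_diff (W : normedModType R) (f g : V -> W) x :
  {near x, f =1 g} -> differentiable f x ->
  differentiable g x /\ 'd g x = 'd f x :> (V -> W).
Proof.
move=> fg df; have fx : f x = g x by exact: nbhs_singleton fg.
have [cf lf] := (diff_locallyP x f).1 df.
have lg : g \o shift x = cst (g x) + 'd f x +o_ 0 id.
  apply/eqaddoP => e e0; have /eqaddoP/(_ e e0) := lf.
  apply: filter_app; rewrite near_simpl.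
  have : \forall y \near 0, f (y + x) = g (y + x).
    move: fg; rewrite (near_shift 0) => fg; apply: filterS fg => y /=.
    by rewrite subr0.
  apply: filterS => y /= fgy; rewrite !fctE /= -fgy -fx //.
have E : 'd g x = 'd f x :> (V -> W) by exact: diff_unique cf lg.
split; last exact: E.
apply/diff_locallyP; rewrite E; split; [exact: cf|exact: lg].
Qed.

Variables (U : set V) (oU : open U).

Lemma eq_ndiff (W : normedModType R) n (f g : V -> W) :
  (forall x, U x -> f x = g x) -> ndiff n U f -> ndiff n U g.
Proof.
elim: n f g => [//|n IH] f g fg [df ndf].
have nfg x : U x -> {near x, f =1 g}.
  by move=> Ux; apply: filterS (open_nbhs_nbhs (conj oU Ux)) => y /fg.
split=> [x Ux|v]; first exact: (near_eq_diff (nfg x Ux) (df x Ux)).1.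
apply: IH (ndf v) => x Ux.
have [_ E] := near_eq_diff (nfg x Ux) (df x Ux).
exact: esym (congr1 (@^~ v) E).
Qed.

Lemma ndiffW (W : normedModType R) n (f : V -> W) : ndiff n.+1 U f -> ndiff n U f.
Proof.
elim: n f => [//|n IH] f [df ndf]; split; first exact: df.
by move=> v; exact: IH (ndf v).
Qed.

Lemma ndiff_cst (W : normedModType R) n (a : W) : ndiff n U (fun=> a).
Proof.
elim: n a => [//|n IH] a; split=> [x _|v]; first exact: differentiable_cst.
apply: eq_ndiff (IH 0) => x _; exact: esym (congr1 (@^~ v) (diff_cst a x)).
Qed.

Lemma ndiffD (W : normedModType R) n (f g : V -> W) :
  ndiff n U f -> ndiff n U g -> ndiff n U (fun x => f x + g x).
Proof.
elim: n f g => [//|n IH] f g [df ndf] [dg ndg].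
split=> [x Ux|v]; first exact: differentiableD (df x Ux) (dg x Ux).
apply: eq_ndiff (IH _ _ (ndf v) (ndg v)) => x Ux.
exact: esym (congr1 (@^~ v) (diffD (df x Ux) (dg x Ux))).
Qed.

Lemma ndiffM n (f g : V -> R) :
  ndiff n U f -> ndiff n U g -> ndiff n U (fun x => f x * g x).
Proof.
elim: n f g => [//|n IH] f g [df ndf] [dg ndg].
split=> [x Ux|v]; first exact: differentiableM (df x Ux) (dg x Ux).
have fW : ndiff n U f by exact: ndiffW (conj df ndf).
have gW : ndiff n U g by exact: ndiffW (conj dg ndg).
apply: eq_ndiff (ndiffD (IH _ _ fW (ndg v)) (IH _ _ gW (ndf v))) => x Ux.
exact: esym (congr1 (@^~ v) (diffM (df x Ux) (dg x Ux))).
Qed.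

End smooth_on_theory.

(** * Smooth manifolds *)

(* A smooth manifold of dimension [mdim], presented by a smooth atlas.  The
   inverse [minv i] of the chart [mchart i : mdom i -> mcod i] is only
   meaningful on [mcod i]. *)
Record manifold (R : realType) := Manifold {
  mspace :> topologicalType;
  mdim : nat;
  mindex : Type;
  mdom : mindex -> set mspace;
  mcod : mindex -> set 'rV[R]_mdim;
  mchart : mindex -> mspace -> 'rV[R]_mdim;
  minv : mindex -> 'rV[R]_mdim -> mspace;
  m_hausdorff : hausdorff_space mspace;
  m_second_countable : @second_countable mspace;
  m_cover : forall p, exists i, mdom i p;
  mdom_open : forall i, open (mdom i);
  mcod_open : forall i, open (mcod i);
  mchart_cod : forall i p, mdom i p -> mcod i (mchart i p);
  minv_dom : forall i u, mcod i u -> mdom i (minv i u);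
  mchartK : forall i p, mdom i p -> minv i (mchart i p) = p;
  minvK : forall i u, mcod i u -> mchart i (minv i u) = u;
  mchart_cont : forall i, {within mdom i, continuous (mchart i)};
  minv_cont : forall i, {within mcod i, continuous (minv i)};
  m_transition : forall i j,
    smooth_on (mcod i `&` minv i @^-1` mdom j) (mchart j \o minv i) }.

Section smooth_functions.
Variables (R : realType) (M : manifold R).

Definition msmooth (V : set M) (f : M -> R) : Prop :=
  forall i, smooth_on (mcod i `&` @minv R M i @^-1` V) (f \o @minv R M i).

Lemma chart_open (V : set M) i :
  open V -> open (mcod i `&` @minv R M i @^-1` V).
Proof.
move=> oV; have /continuousP/(_ V oV) := @minv_cont R M i.
by rewrite -open_setSI//; exact: mcod_open.
Qed.

Lemma msmooth_cst (V : set M) (a : R) : open V -> msmooth V (fun=> a).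
Proof. by move=> oV i n; exact: (ndiff_cst (chart_open oV) n a). Qed.

Lemma msmoothD (V : set M) (f g : M -> R) :
  open V -> msmooth V f -> msmooth V g -> msmooth V (fun p => f p + g p).
Proof.
by move=> oV sf sg i n; have H := ndiffD (chart_open oV) (sf i n) (sg i n); exact: H.
Qed.

Lemma msmoothM (V : set M) (f g : M -> R) :
  open V -> msmooth V f -> msmooth V g -> msmooth V (fun p => f p * g p).
Proof.
by move=> oV sf sg i n; have H := ndiffM (chart_open oV) (sf i n) (sg i n); exact: H.
Qed.

Lemma ndiff_sub (E F : normedModType R) n (U U' : set E) (f : E -> F) :
  U' `<=` U -> ndiff n U f -> ndiff n U' f.
Proof.
move=> sU; elim: n f => [//|n IH] f [df ndf]; split=> [x /sU|v]; first exact: df.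
exact: IH (ndf v).
Qed.

Lemma msmoothW (V : set M) (f : M -> R) : msmooth [set: M] f -> msmooth V f.
Proof. by move=> sf i n; apply: ndiff_sub (sf i n) => u [cu _]; split. Qed.

Definition smooth_fun : {pred M -> R} := fun f => `[< msmooth [set: M] f >].

Lemma smooth_fun_subring : GRing.subring_closed smooth_fun.
Proof.
have oT : open [set: M] := openT.
split=> [|f g /asboolP sf /asboolP sg|f g /asboolP sf /asboolP sg]; apply/asboolP.
- exact: msmooth_cst.
- have sN := msmoothM oT (msmooth_cst (- 1) oT) sg.
  suff -> : f - g = (fun p => f p + (- 1) * g p) by exact: msmoothD.
  by apply/funext => p; rewrite mulN1r.
- exact: msmoothM.
Qed.

Lemma smooth_fun_scale (a : R) (f : M -> R) :
  f \in smooth_fun -> a *: f \in smooth_fun.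
Proof.
move=> /asboolP sf; apply/asboolP.
exact: (msmoothM openT (msmooth_cst a openT) sf).
Qed.

HB.instance Definition _ :=
  GRing.isSubringClosed.Build (M -> R) smooth_fun smooth_fun_subring.
HB.instance Definition _ :=
  GRing.isScaleClosed.Build R (M -> R) smooth_fun smooth_fun_scale.

(* C^oo(M) *)
Record Cinf := MkCinf { cinf_val :> M -> R; _ : smooth_fun cinf_val }.

HB.instance Definition _ := [isSub for cinf_val].
HB.instance Definition _ := [Choice of Cinf by <:].
HB.instance Definition _ :=
  GRing.SubChoice_isSubComPzRing.Build _ _ Cinf (subringClosedP _).
HB.instance Definition _ := [SubZmodule_isSubLmodule of Cinf by <:].

(** * Tangent vectors and vector fields *)

(* T_p M is the space of derivations of C^oo(M) at p. *)
Definition is_tvec (p : M) : {pred Cinf -> R} :=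
  fun v => `[< scalar v /\ forall f g, v (f * g) = f p * v g + g p * v f >].

Lemma is_tvec_submod p : GRing.submod_closed (is_tvec p).
Proof.
split=> [|a u v /asboolP[lu Lu] /asboolP[lv Lv]]; apply/asboolP; split.
- by move=> a f g /=; rewrite mulr0 addr0.
- by move=> f g /=; rewrite !mulr0 addr0.
- move=> b f g; have E (x y z w : R) :
      a * (b * x + y) + (b * z + w) = b * (a * x + z) + (a * y + w) by ring.
  by rewrite !fctE lu lv; exact: E.
- move=> f g; have E (x y z w b c : R) :
      a * (b * x + c * y) + (b * z + c * w) = b * (a * x + z) + c * (a * y + w).
    by ring.
  by rewrite !fctE Lu Lv; exact: E.
Qed.

HB.instance Definition _ p :=
  GRing.isSubmodClosed.Build R (Cinf -> R) (is_tvec p) (is_tvec_submod p).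

Record tvec (p : M) := Tvec { tvec_val :> Cinf -> R; _ : is_tvec p tvec_val }.

HB.instance Definition _ p := [isSub for @tvec_val p].
HB.instance Definition _ p := [Choice of tvec p by <:].
HB.instance Definition _ p := [SubChoice_isSubLmodule of tvec p by <:].

End smooth_functions.

(* Set-theoretic sections of a family of vector spaces, with the pointwise
   vector space structure. *)
Definition sec (R : realType) (T : Type) (F : T -> lmodType R) : Type :=
  forall p, F p.

Section sec_lmodType.
Variables (R : realType) (T : Type) (F : T -> lmodType R).
Implicit Types x y z : sec F.

HB.instance Definition _ := gen_eqMixin (sec F).
HB.instance Definition _ := gen_choiceMixin (sec F).

Let sec_add x y : sec F := fun p => x p + y p.
Let sec_opp x : sec F := fun p => - x p.
Let sec_zero : sec F := fun p => 0.
Let sec_scale (a : R) x : sec F := fun p => a *: x p.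

Let sec_addA : associative sec_add.
Proof. by move=> x y z; apply: functional_extensionality_dep => p; exact: addrA. Qed.
Let sec_addC : commutative sec_add.
Proof. by move=> x y; apply: functional_extensionality_dep => p; exact: addrC. Qed.
Let sec_add0 : left_id sec_zero sec_add.
Proof. by move=> x; apply: functional_extensionality_dep => p; exact: add0r. Qed.
Let sec_addN : left_inverse sec_zero sec_opp sec_add.
Proof. by move=> x; apply: functional_extensionality_dep => p; exact: addNr. Qed.

HB.instance Definition _ :=
  GRing.isZmodule.Build (sec F) sec_addA sec_addC sec_add0 sec_addN.

Let sec_scaleA a b x : sec_scale a (sec_scale b x) = sec_scale (a * b) x.
Proof. by apply: functional_extensionality_dep => p; exact: scalerA. Qed.
Let sec_scale1 : left_id 1 sec_scale.
Proof. by move=> x; apply: functional_extensionality_dep => p; exact: scale1r. Qed.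
Let sec_scaleDr : right_distributive sec_scale +%R.
Proof. by move=> a x y; apply: functional_extensionality_dep => p; exact: scalerDr. Qed.
Let sec_scaleDl x : {morph sec_scale^~ x : a b / a + b}.
Proof. by move=> a b; apply: functional_extensionality_dep => p; exact: scalerDl. Qed.

HB.instance Definition _ := GRing.Zmodule_isLmodule.Build R (sec F)
  sec_scaleA sec_scale1 sec_scaleDr sec_scaleDl.

End sec_lmodType.

Section vector_fields.
Variables (R : realType) (M : manifold R).

Definition is_vfield : {pred sec (fun p : M => tvec p : lmodType R)} :=
  fun X => `[< forall f : Cinf M, msmooth [set: M] (fun p => X p f) >].

Lemma is_vfield_submod : GRing.submod_closed is_vfield.
Proof.
have oT : open [set: M] := openT.
split=> [|a X Y /asboolP sX /asboolP sY]; apply/asboolP => f.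
  exact: msmooth_cst.
exact: msmoothD oT (msmoothM oT (msmooth_cst a oT) (sX f)) (sY f).
Qed.

HB.instance Definition _ :=
  GRing.isSubmodClosed.Build R _ is_vfield is_vfield_submod.

(* The space of smooth vector fields on M *)
Record vfield := Vfield {
  vfield_val :> forall p : M, tvec p;
  _ : is_vfield vfield_val }.

HB.instance Definition _ : isSub (sec _) is_vfield vfield :=
  [isSub for vfield_val].
HB.instance Definition _ := [Choice of vfield by <:].
HB.instance Definition _ := [SubChoice_isSubLmodule of vfield by <:].

(* The function X(f) *)
Fact vact_subproof (X : vfield) (f : Cinf M) : smooth_fun (fun p => X p f).
Proof. by case: X => X /= /asboolP sX; apply/asboolP; exact: sX. Qed.

Definition vact (X : vfield) (f : Cinf M) : Cinf M :=
  MkCinf (vact_subproof X f).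

Lemma tvec_scalar (p : M) (v : tvec p) : scalar v.
Proof. by case: v => v /= /asboolP[]. Qed.

Lemma tvec_leibniz (p : M) (v : tvec p) (f g : Cinf M) : v (f * g) = f p * v g + g p * v f.
Proof. by case: v => v /= /asboolP[]. Qed.

Lemma vact_linear (X : vfield) : linear (vact X).
Proof. by move=> a f g; apply/val_inj/funext => p; exact: tvec_scalar. Qed.

Lemma vactM (X : vfield) f g : vact X (f * g) = f * vact X g + g * vact X f.
Proof. by apply/val_inj/funext => p; exact: tvec_leibniz. Qed.

Lemma tvecD (p : M) (v : tvec p) (f g : Cinf M) : v (f + g) = v f + v g.
Proof. by have := tvec_scalar v 1 f g; rewrite scale1r mul1r. Qed.

Fact vbracket_tvec_subproof (X Y : vfield) (p : M) :
  is_tvec p (fun f => X p (vact Y f) - Y p (vact X f)).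
Proof.
apply/asboolP; split=> [a f g|f g].
  rewrite !vact_linear !tvec_scalar.
  set x := X p _; set x' := X p _; set y := Y p _; set y' := Y p _; ring.
rewrite !vactM !tvecD !tvec_leibniz /=.
by set x := X p (vact _ _); set y := Y p (vact _ _); ring.
Qed.

Fact vbracket_subproof (X Y : vfield) :
  is_vfield (fun p => Tvec (vbracket_tvec_subproof X Y p)).
Proof.
apply/asboolP => f; have oT : open [set: M] := openT.
have smv (Z : vfield) (g : Cinf M) : msmooth [set: M] (fun p => Z p g).
  by apply/asboolP; exact: vact_subproof.
have H := msmoothD oT (smv X (vact Y f))
  (msmoothM oT (msmooth_cst (- 1) oT) (smv Y (vact X f))).
suff -> : (fun p => Tvec (vbracket_tvec_subproof X Y p) f) =
  (fun p => X p (vact Y f) + - 1 * Y p (vact X f)) by [].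
by apply/funext => p /=; rewrite mulN1r.
Qed.

(* The Lie bracket of vector fields *)
Definition vbracket (X Y : vfield) : vfield := Vfield (vbracket_subproof X Y).

End vector_fields.

(** * Vector bundles *)

(* A smooth real vector bundle of rank [vrank] over M, presented by its fibres,
   a family of local trivializations [vtriv i], fibrewise linear isomorphisms
   over the open sets [vdom i], and smooth transition matrices; these data
   determine the topology and smooth structure of the total space. *)
Record vbundle (R : realType) (M : manifold R) := Vbundle {
  vfib :> M -> lmodType R;
  vrank : nat;
  vindex : Type;
  vdom : vindex -> set M;
  vtriv : forall (i : vindex) (p : M), {linear vfib p -> 'rV[R]_vrank};
  v_cover : forall p, exists i, vdom i p;
  vdom_open : forall i, open (vdom i);
  vtriv_bij : forall i p, vdom i p -> bijective (vtriv i p);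
  v_transition : forall i j, exists2 g : M -> 'M[R]_vrank,
    forall p, (vdom i `&` vdom j) p ->
      forall v, vtriv j p v = vtriv i p v *m g p &
    forall s t, msmooth (vdom i `&` vdom j) (fun p => g p s t) }.

Section sections.
Variables (R : realType) (M : manifold R) (A : vbundle M).

Definition is_gsec : {pred sec A} := fun x =>
  `[< forall i k, msmooth (vdom i) (fun p => vtriv i p (x p) 0 k) >].

Lemma is_gsec_submod : GRing.submod_closed is_gsec.
Proof.
split=> [|a x y /asboolP sx /asboolP sy]; apply/asboolP => i k.
  have oi := @vdom_open _ _ A i.
  suff -> : (fun p => vtriv i p ((0 : sec A) p) 0 k) = (fun=> 0).
    exact: msmooth_cst.
  by apply/funext => p; rewrite [X in vtriv i p X]/(0 : A p) linear0 mxE.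
have oi := @vdom_open _ _ A i.
suff -> : (fun p => vtriv i p ((a *: x + y : sec A) p) 0 k) =
    (fun p => a * vtriv i p (x p) 0 k + vtriv i p (y p) 0 k).
  exact: msmoothD oi (msmoothM oi (msmooth_cst a oi) (sx i k)) (sy i k).
by apply/funext => p; rewrite [X in vtriv i p X]/(a *: x p + y p) linearP !mxE.
Qed.

HB.instance Definition _ :=
  GRing.isSubmodClosed.Build R _ is_gsec is_gsec_submod.

(* The space Gamma(A) of smooth sections of A *)
Record gsec := Gsec { gsec_val :> forall p : M, A p; _ : is_gsec gsec_val }.

HB.instance Definition _ : isSub (sec A) is_gsec gsec := [isSub for gsec_val].
HB.instance Definition _ := [Choice of gsec by <:].
HB.instance Definition _ := [SubChoice_isSubLmodule of gsec by <:].

Fact fscale_subproof (f : Cinf M) (x : gsec) : is_gsec (fun p => f p *: x p).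
Proof.
case: x => x /= /asboolP sx; apply/asboolP => i k.
have oi := @vdom_open _ _ A i.
suff -> : (fun p => vtriv i p (f p *: x p) 0 k) =
    (fun p => f p * vtriv i p (x p) 0 k).
  apply: (msmoothM oi _ (sx i k)); apply: msmoothW.
  by case: f => f /= /asboolP.
by apply/funext => p; rewrite linearZ mxE.
Qed.

(* The C^oo(M)-module structure of Gamma(A) *)
Definition fscale (f : Cinf M) (x : gsec) : gsec := Gsec (fscale_subproof f x).

End sections.

(** * Multilinear maps and sections of Hom(Lambda^k A, TM) *)

Definition multilinear (R : realType) (U V : lmodType R) (k : nat)
    (h : ('I_k -> U) -> V) : Prop :=
  forall (x : 'I_k -> U) (i : 'I_k), linear (fun u => h [eta x with i |-> u]).

Definition alternating (U : Type) (V : nmodType) (k : nat)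
    (h : ('I_k -> U) -> V) : Prop :=
  forall (x : 'I_k -> U) (i j : 'I_k), i != j -> x i = x j -> h x = 0.

Section hom_sections.
Variables (R : realType) (M : manifold R) (A : vbundle M).

(* A smooth section of Hom(Lambda^k A, TM): smoothness means that smooth
   sections of A are sent to smooth vector fields. *)
Record homsec (k : nat) := Homsec {
  homsec_val : forall p : M, ('I_k -> A p) -> tvec p;
  homsec_multilinear : forall p, multilinear (@homsec_val p);
  homsec_alternating : forall p, alternating (@homsec_val p);
  homsec_smooth : forall x : 'I_k -> gsec A,
    is_vfield (fun p => homsec_val (fun i => x i p)) }.

Definition homsec_app k (s : homsec k) (x : 'I_k -> gsec A) : vfield M :=
  Vfield (homsec_smooth s x).

End hom_sections.

(** * Left-symmetric algebroids *)

Record lsalgebroid (R : realType) (M : manifold R) (A : vbundle M) :=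
  Lsalgebroid {
  lsmul : gsec A -> gsec A -> gsec A;
  lsmul_linearl : forall y, linear (lsmul^~ y);
  lsmul_linearr : forall x, linear (lsmul x);
  lsmul_leftsym : forall x y z,
    lsmul (lsmul x y) z - lsmul x (lsmul y z) =
    lsmul (lsmul y x) z - lsmul y (lsmul x z);
  anchor : forall p : M, {linear A p -> tvec p};
  anchor_smooth : forall x : gsec A, is_vfield (fun p => anchor p (x p));
  lsmul_fscaler : forall (f : Cinf M) (x y : gsec A),
    lsmul x (fscale f y) =
    fscale f (lsmul x y) + fscale (vact (Vfield (anchor_smooth x)) f) y;
  lsmul_fscalel : forall (f : Cinf M) (x y : gsec A),
    lsmul (fscale f x) y = fscale f (lsmul x y) }.

Definition anchor_app (R : realType) (M : manifold R) (A : vbundle M)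
    (L : lsalgebroid A) (x : gsec A) : vfield M :=
  Vfield (anchor_smooth L x).

Definition lsbracket (R : realType) (M : manifold R) (A : vbundle M)
    (L : lsalgebroid A) (x y : gsec A) : gsec A :=
  lsmul L x y - lsmul L y x.

(** * Multiderivations *)

Section multiderivations.
Variables (R : realType) (M : manifold R) (A : vbundle M).

(* Maps D(x_1, ..., x_(n-1), x_n) of n >= 1 arguments in Gamma(A), with the last
   argument separated from the others. *)
Definition multimap (n : nat) : Type :=
  ('I_n.-1 -> gsec A) -> gsec A -> gsec A.

HB.instance Definition _ n := GRing.Lmodule.copy (multimap n)
  (('I_n.-1 -> gsec A) -> gsec A -> gsec A).

Definition is_symbol n (D : multimap n) (s : homsec A n.-1) : Prop :=
  forall (x : 'I_n.-1 -> gsec A) (f : Cinf M) (y : gsec A),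
    D x (fscale f y) = fscale f (D x y) + fscale (vact (homsec_app s x) f) y.

(* Der^n(A), for n >= 1 *)
Record is_multider n (D : multimap n) : Prop := IsMultider {
  multider_multilinear : forall y, multilinear (D^~ y);
  multider_linear : forall x, linear (D x);
  multider_alternating : forall y, alternating (D^~ y);
  multider_fscale : forall (x : 'I_n.-1 -> gsec A) i (f : Cinf M) y,
    D [eta x with i |-> fscale f (x i)] y = fscale f (D x y);
  multider_symbol : exists s, is_symbol D s }.

End multiderivations.

(** * The differential *)

(* (x_1, ..., ^x_i, ..., x_n) *)
Definition omit (U : Type) n (x : 'I_n -> U) (i : 'I_n) : 'I_n.-1 -> U :=
  x \o lift i.

(* (u, x_1, ..., ^x_i, ..., ^x_j, ..., x_n) for i < j: the entry s.+1 is x at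
   the s-th element of {0, ..., n-1} \ {i, j}. *)
Definition omit2 (U : Type) n (u : U) (x : 'I_n -> U) (i j : 'I_n) :
    'I_n.-1 -> U :=
  fun s => if s is Ordinal s'.+1 _ then x (insubd i (bump j (bump i s')))
           else u.

Section differential.
Variables (R : realType) (M : manifold R) (A : vbundle M) (L : lsalgebroid A).

Local Notation "x ·A y" := (lsmul L x y) (at level 40).
Local Notation "[ x , y ]A" := (lsbracket L x y).

(* Indices start at 0, so that (-1)^(i+1) becomes (-1)^i. *)
Definition d_def n (w : multimap A n) : multimap A n.+1 := fun x y =>
  \sum_(i < n) (-1) ^+ i *: (x i ·A w (omit x i) y)
  + \sum_(i < n) (-1) ^+ i *: (w (omit x i) (x i) ·A y)
  - \sum_(i < n) (-1) ^+ i *: w (omit x i) (x i ·A y)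
  + \sum_(i < n) \sum_(j < n | (i < j)%N)
      (-1) ^+ (i + j)%N *: w (omit2 [x i, x j]A x i j) y.

(* The right-hand side of the formula for the symbol of d_def w, where s is a
   symbol of w. *)
Definition d_def_symbol n (w : multimap A n) (s : homsec A n.-1)
    (x : 'I_n -> gsec A) : vfield M :=
  \sum_(i < n) (-1) ^+ i *: vbracket (anchor_app L (x i))
                              (homsec_app s (omit x i))
  + \sum_(i < n) \sum_(j < n | (i < j)%N)
      (-1) ^+ (i + j)%N *: homsec_app s (omit2 [x i, x j]A x i j)
  + \sum_(i < n) (-1) ^+ i *: anchor_app L (w (omit x i) (x i)).

End differential.

(** * Cochain complexes *)

(* The subsets C n of the vector spaces V n are subspaces and d restricts to
   linear maps C n -> C n.+1 with d o d = 0. *)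
Record is_cochain_complex (R : realType) (V : nat -> lmodType R)
    (C : forall n, set (V n)) (d : forall n, V n -> V n.+1) : Prop :=
  IsCochainComplex {
  cochain0 : forall n, C n 0;
  cochainP : forall n (a : R) x y, C n x -> C n y -> C n (a *: x + y);
  cochain_d : forall n x, C n x -> C n.+1 (d n x);
  cochain_dP : forall n (a : R) x y, C n x -> C n y ->
    d n (a *: x + y) = a *: d n x + d n y;
  cochain_dd : forall n x, C n x -> d n.+1 (d n x) = 0 }.

(* Main.v *)
From HB Require Import structures.
Require Import Defs.
From mathcomp Require Import all_boot all_order all_algebra.
From mathcomp Require Import all_classical all_reals.
From mathcomp Require Import topology normedtype sequences derive realfun exp.
From mathcomp Require Import ring.

(** With g = Gamma(A) under the commutator bracket, the map
    (rho_x phi)(y) = x . phi(y) + phi(x) . y - phi(x . y)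
    makes the linear endomorphisms of g into a g-module, and d_def is the
    Chevalley-Eilenberg differential of this module.  Cartan's formula
    iota_u d = L_u - d iota_u gives alternation of d w and d d = 0 by induction
    on the degree.  The Leibniz rules of the algebroid give C^oo(M)-linearity
    and the symbol formula on sections.  It remains to see that the symbol is a
    tensor, i.e. that its value at p depends only on the values of the sections
    at p: if x(p) = 0 and chi is a bump function at p supported in a
    trivializing open set, then chi^2 x is a sum of f_k e_k with global e_k and
    f_k(p) = 0. *)

Set Implicit Arguments.
Unset Strict Implicit.
Unset Printing Implicit Defensive.

Import Order.TTheory GRing.Theory Num.Theory.
Import numFieldNormedType.Exports.

Local Open Scope classical_set_scope.
Local Open Scope ring_scope.

(** * A decision procedure for identities in abelian groups *)

(** Single terms of the symbol formula fail to be linear over functions, so tensoriality is not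
    checked on the formula. Two symbols of one operator agree at every point where some section does
    not vanish; hence multilinearity, alternation and function-linearity of [d_def L w] in its first
    arguments pass to its symbol. This needs positive rank. In rank 0 all sections vanish and every
    candidate is a symbol; there both sides of the symbol formula are seen to be 0 directly. The
    sums in [d_def] are ill suited to induction on the degree. The differential is therefore rebuilt
    by recursion on the first argument, with Cartan's formula as its definition, and compared with
    the sums only once, on alternating cochains. *)

Inductive zterm :=
  ZVar of nat | ZZero | ZAdd of zterm & zterm | ZOpp of zterm.

Section zterm.
Variable V : zmodType.

Fixpoint zeval (e : seq V) t : V :=
  match t with
  | ZVar i => e`_i
  | ZZero => 0
  | ZAdd t1 t2 => zeval e t1 + zeval e t2
  | ZOpp t => - zeval e t
  end.

Fixpoint zcoef i t : int :=
  match t with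
  | ZVar j => (i == j)%:R
  | ZZero => 0
  | ZAdd t1 t2 => zcoef i t1 + zcoef i t2
  | ZOpp t => - zcoef i t
  end.

Lemma zevalE e t : zeval e t = \sum_(i < size e) e`_i *~ zcoef i t.
Proof.
elim: t => [j||t1 IH1 t2 IH2|t IH] /=.
- case: (ltnP j (size e)) => [lj|gj].
    rewrite (bigD1 (Ordinal lj)) //= eqxx big1 ?addr0 // => i ij.
    by have /negPf -> : (i : nat) != j by apply: contra ij => /eqP ij; apply/eqP/val_inj.
  rewrite nth_default // big1 // => i _.
  by have /negPf -> : (i : nat) != j by rewrite neq_ltn (leq_trans (ltn_ord i) gj).
- by rewrite big1.
- by rewrite IH1 IH2 -big_split; apply: eq_bigr => i _; rewrite mulrzDr.
- by rewrite IH -sumrN; apply: eq_bigr => i _; rewrite mulrNz.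
Qed.

Lemma zeval_eq e t1 t2 :
  all (fun i => zcoef i t1 == zcoef i t2) (iota 0 (size e)) ->
  zeval e t1 = zeval e t2.
Proof.
move=> /allP h; rewrite !zevalE; apply: eq_bigr => i _.
by rewrite (eqP (h i _)) // mem_iota /= add0n ltn_ord.
Qed.

End zterm.

(* Atoms are compared up to conversion: syntactic comparison would separate
   terms that differ only in the inferred structure instances. *)
Ltac zindex x l :=
  lazymatch l with
  | cons ?y ?l' =>
    match constr:(Set) with
    | _ => let _ := match constr:(Set) with _ => unify x y end in constr:(0%N)
    | _ => let n := zindex x l' in constr:(S n)
    end
  end.

Ltac zatoms x l :=
  lazymatch x with
  | ?a + ?b => let l := zatoms a l in zatoms b l
  | - ?a => zatoms a l
  | 0 => l
  | _ => match constr:(Set) with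
         | _ => let _ := zindex x l in l
         | _ => constr:(cons x l)
         end
  end.

Ltac zreify x l :=
  lazymatch x with
  | ?a + ?b => let a := zreify a l in let b := zreify b l in constr:(ZAdd a b)
  | - ?a => let a := zreify a l in constr:(ZOpp a)
  | 0 => constr:(ZZero)
  | _ => let n := zindex x l in constr:(ZVar n)
  end.

Ltac zmod :=
  lazymatch goal with
  | |- @eq ?T ?a ?b =>
    let l := zatoms a (@nil T) in
    let l := zatoms b l in
    let ta := zreify a l in
    let tb := zreify b l in
    (* The goal is convertible to the equation between the evaluated terms; what remains is a closed
       boolean test on integer coefficients. *)
    refine (@zeval_eq _ l ta tb _); by []
  end.

(** * The Chevalley-Eilenberg complex *)

Section cons_fun.
Variable U : Type.

Definition consf k (u : U) (y : 'I_k -> U) : 'I_k.+1 -> U :=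
  fun i => if unlift ord0 i is Some j then y j else u.

Definition tailf k (x : 'I_k.+1 -> U) : 'I_k -> U := fun j => x (lift ord0 j).

Lemma consf0 k u (y : 'I_k -> U) : consf u y ord0 = u.
Proof. by rewrite /consf unlift_none. Qed.

Lemma consfS k u (y : 'I_k -> U) j : consf u y (lift ord0 j) = y j.
Proof. by rewrite /consf liftK. Qed.

Lemma tailf_cons k u (y : 'I_k -> U) : tailf (consf u y) = y.
Proof. by apply/funext => j; exact: consfS. Qed.

Lemma consf_tail k (x : 'I_k.+1 -> U) : consf (x ord0) (tailf x) = x.
Proof. by apply/funext => i; rewrite /consf; case: unliftP => [j|] ->. Qed.

Lemma upd_consf0 k (x : 'I_k.+1 -> U) u :
  ([eta x with ord0 |-> u] : 'I_k.+1 -> U) = consf u (tailf x).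
Proof. by apply/funext => i; rewrite /consf /=; case: unliftP => [j|] ->. Qed.

Lemma upd_consfS k (x : 'I_k.+1 -> U) j u :
  ([eta x with lift ord0 j |-> u] : 'I_k.+1 -> U) =
  consf (x ord0) [eta tailf x with j |-> u].
Proof.
apply/funext => i; rewrite /consf /=; case: unliftP => [j'|] -> //.
Qed.

Lemma omit_consf0 k u (y : 'I_k -> U) : omit (consf u y) ord0 = y.
Proof. exact: tailf_cons. Qed.

Lemma omit_consfS k u (y : 'I_k.+1 -> U) j :
  omit (consf u y) (lift ord0 j) = consf u (omit y j).
Proof.
apply/funext => i; rewrite /omit /=; case: (unliftP ord0 i) => [i'|] ->.
  rewrite consfS /= -(consfS u y); congr (consf u y _).
  by apply/val_inj; rewrite /= /bump !add1n ltnS addnS.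
rewrite consf0 -[RHS](consf0 u y); congr (consf u y _).
exact/val_inj.
Qed.

Lemma omit2_consf0 k (w u : U) (y : 'I_k.+1 -> U) (j : 'I_k.+1) :
  omit2 w (consf u y) ord0 (lift ord0 j) = consf w (omit y j).
Proof.
apply/funext => i; case: (unliftP ord0 i) => [i'|] ->; last by rewrite consf0.
rewrite consfS /omit2 /omit /= -(consfS u y); congr (consf u y _).
have E : bump (bump 0 j) (bump 0 i') = bump 0 (bump j i').
  by rewrite /bump !add1n ltnS addnS.
(* The index is the value of [lift ord0 (lift j i')], hence in range, and [insubd] does not take its
   default. *)
apply/val_inj; rewrite val_insubd E.
by have := ltn_ord (lift ord0 (lift j i')); rewrite /= => ->.
Qed.

(** The old head [u] lands just behind the bracket [w], so that one transposition brings it to the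
    front. *)
Lemma omit2_consfS k (w u : U) (y : 'I_k.+2 -> U) (i j : 'I_k.+2) :
  omit2 w (consf u y) (lift ord0 i) (lift ord0 j) =
  consf w (consf u (tailf (omit2 w y i j))).
Proof.
apply/funext => s; case: (unliftP ord0 s) => [s'|] ->; last by rewrite consf0.
rewrite consfS; case: (unliftP ord0 s') => [t|] ->.
  rewrite consfS /tailf /omit2 /= -(consfS u y).
  have E : bump (bump 0 j) (bump (bump 0 i) (bump 0 t)) =
    bump 0 (bump j (bump i t)).
    by rewrite /bump !add1n !ltnS addnS ltnS addnS.
  congr (consf u y _); apply/val_inj; rewrite val_insubd /= val_insubd E.
  have -> : (bump 0 (bump j (bump i t)) < k.+3)%N = (bump j (bump i t) < k.+2)%N by [].
  by case: ifP.
rewrite consf0 /omit2 /= -[RHS](consf0 u y); congr (consf u y _).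
by apply/val_inj; rewrite val_insubd.
Qed.

End cons_fun.

Section fun_lmodType.
Variables (R : realType) (T : Type) (V : lmodType R).
Implicit Types f g : T -> V.

Lemma combB a (x y x' y' : V) :
  a *: x + x' - (a *: y + y') = a *: (x - y) + (x' - y').
Proof. by rewrite scalerDr scalerN opprD addrACA. Qed.

Lemma funDE f g x : (f + g) x = f x + g x. Proof. by []. Qed.
Lemma funNE f x : (- f) x = - f x. Proof. by []. Qed.
Lemma funZE a f x : (a *: f) x = a *: f x. Proof. by []. Qed.
Definition fE := (funDE, funNE, funZE).

End fun_lmodType.

(** * Cartan calculus for a module over a Lie algebra *)

Section chevalley_eilenberg.
Variables (R : realType) (g V : lmodType R).
(** [V] will be the space of all maps on Gamma(A), whereas the module axioms hold only on the linear
    ones; [good] singles these out without forming a subtype. *)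
Variables (br : g -> g -> g) (rho : g -> V -> V) (good : V -> Prop).
Hypothesis br_linl : forall v, linear (br^~ v).
Hypothesis br_linr : forall u, linear (br u).
Hypothesis brxx : forall u, br u u = 0.
Hypothesis jacobi : forall u v w,
  br (br u v) w = br u (br v w) - br v (br u w).
Hypothesis goodP : forall a p q, good p -> good q -> good (a *: p + q).
Hypothesis rho_linr : forall u, linear (rho u).
Hypothesis rho_linl : forall p, good p -> linear (rho^~ p).
Hypothesis rho_good : forall u p, good p -> good (rho u p).
Hypothesis rho_br : forall u v p, good p ->
  rho (br u v) p = rho u (rho v p) - rho v (rho u p).

Local Notation C k := (('I_k -> g) -> V).

Definition contr k (u : g) (c : C k.+1) : C k := fun y => c (consf u y).

(* [lie] and [ced] are defined by recursion on the first argument, through the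
   commutation rule [L_u, iota_v] = iota_[u, v] and Cartan's formula; [ceE]
   identifies [ced] with the usual sum on alternating cochains. *)
Fixpoint lie (u : g) k : C k -> C k :=
  match k return C k -> C k with
  | 0 => fun c y => rho u (c y)
  | k'.+1 => fun c y =>
      lie u (contr (y ord0) c) (tailf y) - c (consf (br u (y ord0)) (tailf y))
  end.

Fixpoint ced k : C k -> C k.+1 :=
  match k return C k -> C k.+1 with
  | 0 => fun c x => rho (x ord0) (c (tailf x))
  | k'.+1 => fun c x =>
      lie (x ord0) c (tailf x) - ced (contr (x ord0) c) (tailf x)
  end.

(* Alternating multilinear cochains with values in [good]; alternation need only
   be tested on the first two arguments. *)
Fixpoint coch k : C k -> Prop :=
  match k return C k -> Prop with
  | 0 => fun c => forall x, good (c x)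
  | k'.+1 => fun c =>
    [/\ forall y, linear (fun u => c (consf u y)),
        forall u, coch (contr u c) &
        forall u y (i : 'I_k'), i = 0%N :> nat -> y i = u -> c (consf u y) = 0]
  end.

(** The engine of the inductions on the degree: contraction lowers the degree, and identities may be
    checked after it. *)
Lemma contr_ext k (c c' : C k.+1) : (forall u, contr u c = contr u c') -> c = c'.
Proof.
move=> E; apply/funext => x; rewrite -(consf_tail x).
exact: (congr1 (fun h => h (tailf x)) (E (x ord0))).
Qed.

Lemma lieS k u (c : C k.+1) y : lie u c y =
  lie u (contr (y ord0) c) (tailf y) - c (consf (br u (y ord0)) (tailf y)).
Proof. by []. Qed.

Lemma cedS k (c : C k.+1) x :
  ced c x = lie (x ord0) c (tailf x) - ced (contr (x ord0) c) (tailf x).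
Proof. by []. Qed.

Lemma lie0E u (c : C 0) y : lie u c y = rho u (c y).
Proof. by []. Qed.

Lemma ced0E (c : C 0) x : ced c x = rho (x ord0) (c (tailf x)).
Proof. by []. Qed.


Lemma contr_lie k u v (c : C k.+1) :
  contr v (lie u c) = lie u (contr v c) - contr (br u v) c.
Proof. by apply/funext => y; rewrite /contr lieS consf0 tailf_cons. Qed.

Lemma contr_ced k u (c : C k.+1) : contr u (ced c) = lie u c - ced (contr u c).
Proof. by apply/funext => y; rewrite /contr cedS consf0 tailf_cons. Qed.

Lemma contr_ced0 u (c : C 0) : contr u (ced c) = lie u c.
Proof. by apply/funext => y; rewrite /contr ced0E consf0 tailf_cons. Qed.

Lemma contr_comb k u a (c c' : C k.+1) :
  contr u (a *: c + c') = a *: contr u c + contr u c'.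
Proof. by []. Qed.

Lemma lie_linear k u : linear (@lie u k).
Proof.
elim: k => [|k IH] a c c'; apply/funext => y.
  by rewrite !fE !lie0E rho_linr.
by rewrite !fE !lieS contr_comb IH !fE combB.
Qed.

Lemma ced_linear k : linear (@ced k).
Proof.
elim: k => [|k IH] a c c'; apply/funext => y.
  by rewrite !fE !ced0E rho_linr.
by rewrite !fE !cedS lie_linear contr_comb IH !fE combB.
Qed.

Lemma coch_comb k a (c c' : C k) : coch c -> coch c' -> coch (a *: c + c').
Proof.
elim: k c c' => [|k IH] c c'; first by move=> h h' x; exact: goodP.
move=> [l i e] [l' i' e']; split=> [y b u v|u|u y j j0 yj].
- rewrite !fE l l' !scalerDr !scalerA addrACA; congr (_ + _ + _).
  by rewrite mulrC.
- by rewrite contr_comb; apply: IH; [exact: i|exact: i'].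
- by rewrite !fE (e _ _ _ j0 yj) (e' _ _ _ j0 yj) scaler0 addr0.
Qed.

Lemma cochB k (c c' : C k) : coch c -> coch c' -> coch (c - c').
Proof.
move=> h h'; rewrite addrC -scaleN1r; exact: coch_comb.
Qed.

Lemma contr_linear k (c : C k.+1) : coch c -> linear ((fun u => contr u c) : g -> C k).
Proof. by move=> [l _ _] a u v; apply/funext => y; exact: l. Qed.

Lemma coch_contr k (c : C k.+1) u : coch c -> coch (contr u c).
Proof. by case=> _ i _; exact: i. Qed.

Lemma contr_contr k (c : C k.+2) u : coch c -> contr u (contr u c) = 0.
Proof.
case=> _ _ h; apply/funext => y; apply: (h _ _ ord0) => //.
exact: consf0.
Qed.

(** Polarization of [contr_contr]: in the double contraction with [u + v] the diagonal terms
    vanish. *)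
Lemma contrC k (c : C k.+2) u v : coch c ->
  contr u (contr v c) = - contr v (contr u c).
Proof.
move=> h; have := contr_contr (u + v) h.
have linD (d : C k.+2) p q : coch d -> contr (p + q) d = contr p d + contr q d.
  by move=> hd; have := contr_linear hd 1 p q; rewrite !scale1r.
rewrite linD // /contr.
have := contr_linear (coch_contr u h) 1 u v.
have := contr_linear (coch_contr v h) 1 u v.
rewrite !scale1r => E1 E2 E3.
apply/eqP; rewrite -addr_eq0; apply/eqP.
have -> : contr u (contr v c) + contr v (contr u c) =
   contr (u + v) (contr u c) + contr (u + v) (contr v c).
  by rewrite E1 E2 !contr_contr // add0r addr0 addrC.
exact: E3.
Qed.


Lemma lieB k u (c c' : C k) : lie u (c - c') = lie u c - lie u c'.
Proof. by rewrite -scaleN1r addrC lie_linear scaleN1r addrC. Qed.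

Lemma cedB k (c c' : C k) : ced (c - c') = ced c - ced c'.
Proof. by rewrite -scaleN1r addrC ced_linear scaleN1r addrC. Qed.

Lemma contrB k u (c c' : C k.+1) : contr u (c - c') = contr u c - contr u c'.
Proof. by []. Qed.

Lemma lie0 k u : lie u (0 : C k) = 0.
Proof. by rewrite -{1}(subrr 0) lieB subrr. Qed.

Lemma ced0 k : ced (0 : C k) = 0.
Proof. by rewrite -{1}(subrr 0) cedB subrr. Qed.

Lemma coch_lie k u (c : C k) : coch c -> coch (lie u c).
Proof.
elim: k c => [|k IH] c; first by move=> h x; rewrite lie0E; exact: rho_good.
move=> h; have [l i e] := h; split=> [y a v v'|v|v y j j0 yj].
- rewrite !lieS !consf0 !tailf_cons contr_linear // lie_linear br_linr l.
  by rewrite !fE combB.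
- rewrite contr_lie; apply: cochB; last exact: coch_contr.
  by apply: IH; exact: coch_contr.
- case: k c IH h l i e y j j0 yj => [c _ _ _ _ _ y [] //|k c IH h l i e y j j0].
  have -> : j = ord0 by exact/val_inj.
  move=> yj; rewrite -(consf_tail y) yj.
  have -> : lie u c (consf v (consf v (tailf y))) =
    contr v (contr v (lie u c)) (tailf y) by [].
  rewrite !contr_lie.
  have -> : contr v (lie u (contr v c) - contr (br u v) c) =
    contr v (lie u (contr v c)) - contr v (contr (br u v) c) by [].
  (* Contracting [L_u c] twice with [v] leaves [L_u iota_v iota_v c], which is 0, and two mixed
     terms in [v] and [[u, v]], which cancel by antisymmetry. *)
  by rewrite contr_lie contr_contr // (contrC _ _ h) opprK addrK lie0.
Qed.

Lemma lie_linearl k (c : C k) : coch c -> linear ((fun u => lie u c) : g -> C k).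
Proof.
elim: k c => [|k IH] c h a u v; apply/funext => y.
  by rewrite !fE !lie0E rho_linl.
have [l i _] := h.
by rewrite !fE !lieS (IH _ (coch_contr _ h)) br_linl l !fE combB.
Qed.

Lemma coch_ced k (c : C k) : coch c -> coch (ced c).
Proof.
elim: k c => [|k IH] c h.
  split=> [y a u v|u|u y [] //].
    by rewrite !ced0E !consf0 !tailf_cons rho_linl.
  by rewrite contr_ced0; exact: coch_lie.
have [l i e] := h; split=> [y a u v|u|u y j j0].
- rewrite !cedS !consf0 !tailf_cons lie_linearl // contr_linear // ced_linear.
  by rewrite !fE combB.
- by rewrite contr_ced; apply: cochB; [exact: coch_lie|apply: IH; exact: coch_contr].
have -> : j = ord0 by exact/val_inj.
move=> yj; rewrite -(consf_tail y) yj.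
have -> : ced c (consf u (consf u (tailf y))) =
  contr u (contr u (ced c)) (tailf y) by [].
(* Cartan's formula gives [iota_u iota_u d c = L_u iota_u c - iota_[u,u] c - iota_u d iota_u c], and
   once more it turns the last term into [L_u iota_u c]. *)
rewrite contr_ced contrB contr_lie brxx.
have -> : contr 0 c = 0.
  have := contr_linear h 1 0 0; rewrite !scale1r addr0 => E.
  by apply: (addrI (contr 0 c)); rewrite addr0 -E.
rewrite subr0.
case: k c {IH l i e} h y j {j0 yj} => [c _ y _|k c h y _].
  by rewrite contr_ced0 subrr.
by rewrite contr_ced contr_contr // ced0 subr0 subrr.
Qed.

(** Contraction with [w] leaves the same identity for [contr w c] and contractions with iterated
    brackets, which the Jacobi identity balances. *)
Lemma lie_br k u v (c : C k) : coch c ->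
  lie (br u v) c = lie u (lie v c) - lie v (lie u c).
Proof.
elim: k c => [|k IH] c h; first by apply/funext => y; rewrite !fE !lie0E; exact: rho_br.
apply: contr_ext => w; have hw := coch_contr w h.
rewrite contrB !contr_lie !lieB IH // jacobi.
have contrBl p q : contr (p - q) c = contr p c - contr q c.
  by rewrite -scaleN1r addrC contr_linear // scaleN1r addrC.
rewrite contrBl.
zmod.
Qed.

(** After contraction with [v], Cartan's formula leaves the identity for [contr v c] together with
    the commutator rule [lie_br]. *)
Lemma lie_ced k u (c : C k) : coch c -> lie u (ced c) = ced (lie u c).
Proof.
elim: k c => [|k IH] c h; apply: contr_ext => v.
  by rewrite contr_lie !contr_ced0 lie_br // subKr.
rewrite contr_lie !contr_ced lieB IH ?contr_lie ?cedB; last exact: coch_contr.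
rewrite lie_br //; zmod.
Qed.

Lemma ced_ced k (c : C k) : coch c -> ced (ced c) = 0.
Proof.
elim: k c => [|k IH] c h; apply: contr_ext => u.
  rewrite contr_ced contr_ced0 lie_ced // subrr.
  by [].
rewrite contr_ced contr_ced cedB IH; last exact: coch_contr.
by rewrite lie_ced // subr0 subrr.
Qed.

Lemma coch_swap k (c : C k.+2) u v y : coch c ->
  c (consf u (consf v y)) = - c (consf v (consf u y)).
Proof. by move=> /(contrC v u) /(congr1 (fun h => h y)). Qed.

(** In the usual formula [[u, y_j]] stands in place of [y_j]; moving it to the front costs the sign
    [(-1)^j], as in the double sum of [ce]. *)
Lemma lieE k u (c : C k.+1) y : coch c -> lie u c y =
  rho u (c y) - \sum_(j < k.+1) (-1) ^+ j *: c (consf (br u (y j)) (omit y j)).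
Proof.
elim: k c y => [|k IH] c y h; rewrite lieS.
  by rewrite big_ord1 expr0 scale1r lie0E /contr consf_tail.
rewrite (IH _ _ (coch_contr _ h)) /contr consf_tail [in RHS]big_ord_recl expr0 scale1r.
rewrite -addrA -opprD [X in _ - X = _]addrC. congr (_ - (_ + _)).
apply: eq_bigr => j _; rewrite coch_swap // exprS mulN1r scaleNr scalerN.
congr (- (_ *: c (consf _ _))).
by rewrite -omit_consfS consf_tail.
Qed.

Definition ce k (c : C k) : C k.+1 := fun x =>
  \sum_(i < k.+1) (-1) ^+ i *: rho (x i) (c (omit x i)) +
  \sum_(i < k.+1) \sum_(j < k.+1 | (i < j)%N)
    (-1) ^+ (i + j)%N *: c (omit2 (br (x i) (x j)) x i j).

Lemma omit2_head k (w : g) (y : 'I_k.+2 -> g) i j :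
  omit2 w y i j = consf w (tailf (omit2 w y i j)).
Proof. by rewrite -[LHS]consf_tail. Qed.

(** Shifting both indices preserves the parity of their sum; the minus sign comes from exchanging
    [u] with the bracket. *)
Lemma omit2_sum_contr k u (c : C k.+1) y : coch c ->
  \sum_(i < k.+1) \sum_(j < k.+1 | (i < j)%N) (-1) ^+ (bump 0 i + bump 0 j)%N *:
    c (omit2 (br (y i) (y j)) (consf u y) (lift ord0 i) (lift ord0 j)) =
  - \sum_(i < k.+1) \sum_(j < k.+1 | (i < j)%N) (-1) ^+ (i + j)%N *:
    contr u c (omit2 (br (y i) (y j)) y i j).
Proof.
case: k c y => [|k] c y h.
  by rewrite !big1 ?oppr0 // => i _; rewrite big_pred0 // => j; rewrite !ord1.
rewrite -sumrN; apply: eq_bigr => i _; rewrite -sumrN; apply: eq_bigr => j _.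
rewrite omit2_consfS coch_swap // -omit2_head scalerN.
by rewrite /bump !add1n addSn addnS !exprS !mulN1r opprK.
Qed.

(** The terms with [i = 0] in the two sums make up [lieE]; those with [i > 0] are minus the two sums
    for the contracted cochain. *)
Lemma ceE k (c : C k) : coch c -> ce c = ced c.
Proof.
elim: k c => [|k IH] c h; apply/funext => x.
  rewrite ced0E /ce big_ord1 [X in _ + X]big1; first by rewrite addr0 expr0 scale1r.
  by move=> i _; rewrite big_pred0 // => j; rewrite !ord1.
rewrite cedS -(IH _ (coch_contr _ h)) lieE //.
rewrite -(consf_tail x) tailf_cons consf0; move: (x ord0) (tailf x) => u y.
rewrite /ce big_ord_recl /= consf0 omit_consf0 expr0 scale1r opprD.
rewrite [X in _ + X = _]big_ord_recl.
rewrite -[LHS]addrA -[RHS]addrA; congr (_ + _).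
have -> : \sum_(i < k.+1) (-1) ^+ bump 0 i *: rho (consf u y (lift ord0 i))
    (c (omit (consf u y) (lift ord0 i))) =
  - \sum_(i < k.+1) (-1) ^+ i *: rho (y i) (contr u c (omit y i)).
  rewrite -sumrN; apply: eq_bigr => i _.
  by rewrite consfS omit_consfS -[bump 0 i]/i.+1 exprS mulN1r scaleNr.
rewrite addrCA; congr (_ + (_ + _)).
  rewrite big_mkcond big_ord_recl /= add0r -sumrN; apply: eq_bigr => j _.
  by rewrite consfS consf0 omit2_consf0 add0n -[bump 0 j]/j.+1 exprS mulN1r scaleNr.
rewrite -omit2_sum_contr //; apply: eq_bigr => i _.
rewrite big_mkcond big_ord_recl /= add0r -big_mkcond /=.
apply: eq_bigr => j _; by rewrite !consfS.
Qed.

(** Reduces a property of an arbitrary slot to the first one, where the recursive definitions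
    apply. *)
Lemma coch_slot k (c : C k.+1) (i : 'I_k.+1) y : coch c ->
  c y = (-1) ^+ i *: c (consf (y i) (omit y i)).
Proof.
elim: k c i y => [|k IH] c i y h.
  by rewrite !ord1 expr0 scale1r consf_tail.
case: (unliftP ord0 i) => [j|] ->; last by rewrite expr0 scale1r consf_tail.
rewrite -{1}(consf_tail y).
have := IH _ j (tailf y) (coch_contr (y ord0) h); rewrite /contr => ->.
rewrite coch_swap // -[consf (y ord0) _]omit_consfS consf_tail -[lift ord0 j : nat]/j.+1.
by rewrite exprS mulN1r scaleNr scalerN.
Qed.

Lemma coch_multilinear k (c : C k) : coch c -> multilinear c.
Proof.
elim: k c => [|k IH] c h x i; first by case: i.
have [l _ _] := h; move=> a u v.
case: (unliftP ord0 i) => [j|] ->; last by rewrite !upd_consf0 l.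
rewrite !upd_consfS; exact: (IH _ (coch_contr (x ord0) h) (tailf x) j a u v).
Qed.

Lemma coch_alternating k (c : C k) : coch c -> alternating c.
Proof.
elim: k c => [|k IH] c h x i j; first by case: i.
(* An entry equal to the head is moved next to it, where a double contraction kills the value. *)
have c0 u (y : 'I_k -> g) (m : 'I_k) : y m = u -> c (consf u y) = 0.
  case: k {IH} c h {x i j} y m => [|k] c h y m; first by case: m.
  move=> ym; have := coch_slot m y (coch_contr u h); rewrite /contr => ->.
  have := congr1 (fun f => f (omit y m)) (contr_contr u h).
  by rewrite /contr ym => ->; rewrite scaler0.
case: (unliftP ord0 i) => [i'|] ->; case: (unliftP ord0 j) => [j'|] -> //.
- rewrite (inj_eq lift_inj) => ij xij; rewrite -(consf_tail x).
  exact: (IH _ (coch_contr (x ord0) h) (tailf x) i' j' ij).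
- by move=> _ xij; rewrite -(consf_tail x); exact: c0 xij.
- by move=> _ xij; rewrite -(consf_tail x); exact: c0 (esym xij).
Qed.

Lemma coch_good k (c : C k) x : coch c -> good (c x).
Proof.
elim: k c x => [|k IH] c x h; first exact: h.
by rewrite -(consf_tail x); exact: IH (tailf x) (coch_contr (x ord0) h).
Qed.

Lemma multilinear_coch k (c : C k) :
  multilinear c -> alternating c -> (forall x, good (c x)) -> coch c.
Proof.
elim: k c => [|k IH] c m al gd; first exact: gd.
split=> [y a u v|u|u y i _ yi].
- have := m (consf 0 y) ord0 a u v; rewrite !upd_consf0 tailf_cons; exact.
- apply: IH => [x i a v w|x i j ij xij|x]; last exact: gd.
    have := m (consf u x) (lift ord0 i) a v w.
    by rewrite !upd_consfS consf0 tailf_cons; exact.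
  by apply: (al _ (lift ord0 i) (lift ord0 j)); rewrite ?consfS ?(inj_eq lift_inj).
- by apply: (al _ ord0 (lift ord0 i)); rewrite ?consfS ?consf0.
Qed.

End chevalley_eilenberg.

(** * The differential on sections *)

Section linear_functions.
Variables (R : realType) (U V : lmodType R) (h : U -> V).
Hypothesis lin_h : linear h.

Lemma lin0 : h 0 = 0.
Proof. by have := lin_h (-1) 0 0; rewrite !scaleN1r !addNr. Qed.

Lemma linD x y : h (x + y) = h x + h y.
Proof. by have := lin_h 1 x y; rewrite !scale1r. Qed.

Lemma linZ a x : h (a *: x) = a *: h x.
Proof. by have := lin_h a x 0; rewrite lin0 !addr0. Qed.

Lemma linN x : h (- x) = - h x.
Proof. by rewrite -scaleN1r linZ scaleN1r. Qed.

Lemma linB x y : h (x - y) = h x - h y.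
Proof. by rewrite linD linN. Qed.

Lemma lin_sum (I : finType) (P : pred I) F :
  h (\sum_(i | P i) F i) = \sum_(i | P i) h (F i).
Proof. by elim/big_rec2: _ => [|i y x _ <-]; [exact: lin0|exact: linD]. Qed.

End linear_functions.

Section sections_module.
Variables (R : realType) (M : manifold R) (A : vbundle M).
Implicit Types (f g : Cinf M) (x y : gsec A) (X Y : vfield M).

Lemma gsecP x y : (forall p, x p = y p) -> x = y.
Proof. by move=> E; apply/val_inj/functional_extensionality_dep. Qed.

Lemma vfieldP X Y : (forall p f, X p f = Y p f) -> X = Y.
Proof.
move=> E; apply/val_inj/functional_extensionality_dep => p.
by apply/val_inj/funext => f; exact: E.
Qed.

Lemma cinfP f g : (forall p, f p = g p) -> f = g.
Proof. by move=> E; apply/val_inj/funext. Qed.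

Lemma fscaleDr f x y : fscale f (x + y) = fscale f x + fscale f y.
Proof. by apply: gsecP => p; exact: scalerDr. Qed.

Lemma fscaleNr f x : fscale f (- x) = - fscale f x.
Proof. by apply: gsecP => p; exact: scalerN. Qed.

Lemma fscaleZr f a x : fscale f (a *: x) = a *: fscale f x.
Proof.
apply: gsecP => p; change (f p *: (a *: x p) = a *: (f p *: x p)).
by rewrite !scalerA mulrC.
Qed.

Lemma fscaleDl f g x : fscale (f + g) x = fscale f x + fscale g x.
Proof. by apply: gsecP => p; exact: scalerDl. Qed.

Lemma fscaleNl f x : fscale (- f) x = - fscale f x.
Proof. by apply: gsecP => p; exact: scaleNr. Qed.

Lemma fscaleZl a f x : fscale (a *: f) x = a *: fscale f x.
Proof. by apply: gsecP => p; rewrite [RHS]scalerA. Qed.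

Lemma fscaleA f g x : fscale f (fscale g x) = fscale (f * g) x.
Proof. by apply: gsecP => p; exact: scalerA. Qed.

Lemma fscale_linear f : linear (fscale f : gsec A -> gsec A).
Proof. by move=> a x y; rewrite fscaleDr fscaleZr. Qed.

Lemma fscale0l x : fscale 0 x = 0.
Proof. by apply: gsecP => p; exact: scale0r. Qed.

Lemma vact_comb a X Y f : vact (a *: X + Y) f = a *: vact X f + vact Y f.
Proof. by apply: cinfP. Qed.

Lemma vactD X Y f : vact (X + Y) f = vact X f + vact Y f.
Proof. by apply: cinfP. Qed.

Lemma vact0 f : vact (0 : vfield M) f = 0.
Proof. by apply: cinfP. Qed.

Lemma vact_bracket X Y f :
  vact (vbracket X Y) f = vact X (vact Y f) - vact Y (vact X f).
Proof. by apply: cinfP. Qed.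

End sections_module.

(** * The module of endomorphisms of Gamma(A), and symbols *)

Section algebroid.
Variables (R : realType) (M : manifold R) (A : vbundle M) (L : lsalgebroid A).
Implicit Types (f : Cinf M) (x y u v : gsec A) (X Y S : vfield M).
Local Notation V := (gsec A -> gsec A).
Implicit Types p q : V.
Local Notation "x ·A y" := (lsmul L x y) (at level 40).
Local Notation br := (lsbracket L).
Local Notation anc := (anchor_app L).

Lemma lsmulDl x y z : (x + y) ·A z = x ·A z + y ·A z.
Proof. exact: (linD (lsmul_linearl L z)). Qed.
Lemma lsmulNl x z : (- x) ·A z = - (x ·A z).
Proof. exact: (linN (lsmul_linearl L z)). Qed.
Lemma lsmulZl a x z : (a *: x) ·A z = a *: (x ·A z).
Proof. exact: (linZ (lsmul_linearl L z)). Qed.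
Lemma lsmulDr x y z : x ·A (y + z) = x ·A y + x ·A z.
Proof. exact: (linD (lsmul_linearr L x)). Qed.
Lemma lsmulNr x z : x ·A (- z) = - (x ·A z).
Proof. exact: (linN (lsmul_linearr L x)). Qed.
Lemma lsmulZr a x z : x ·A (a *: z) = a *: (x ·A z).
Proof. exact: (linZ (lsmul_linearr L x)). Qed.
Definition lsmulE := (lsmulDl, lsmulNl, lsmulZl, lsmulDr, lsmulNr, lsmulZr).

(** Left-symmetry oriented as a rewrite rule: applied to one order of each pair, it reduces the
    identities below to additive ones. *)
Lemma lsassocl x y z :
  (x ·A y) ·A z = x ·A (y ·A z) + (y ·A x) ·A z - y ·A (x ·A z).
Proof.
have h := lsmul_leftsym L x y z.
have -> : (x ·A y) ·A z = ((x ·A y) ·A z - x ·A (y ·A z)) + x ·A (y ·A z) by zmod.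
rewrite h; zmod.
Qed.

Lemma lsmul_frl f x y :
  x ·A fscale f y = fscale f (x ·A y) + fscale (vact (anc x) f) y.
Proof. exact: lsmul_fscaler. Qed.

Lemma br_linearl v : linear (br^~ v).
Proof. move=> a x y; rewrite /lsbracket !lsmulE scalerDr scalerN. zmod. Qed.

Lemma br_linearr u : linear (br u).
Proof. by move=> a x y; rewrite /lsbracket !lsmulE scalerDr scalerN; zmod. Qed.

Lemma br_xx u : br u u = 0.
Proof. exact: subrr. Qed.

Lemma br_jacobi x y z : br (br x y) z = br x (br y z) - br y (br x z).
Proof.
rewrite /lsbracket !lsmulE (lsassocl x y z) (lsassocl y z x) (lsassocl x z y).
zmod.
Qed.

Definition adj x p : V := fun y => x ·A p y + p x ·A y - p (x ·A y).

Lemma adj_linearr x : linear (adj x).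
Proof.
move=> a p q; apply/funext => y; rewrite /adj !fE !lsmulE !scalerDr !scalerN.
zmod.
Qed.

Lemma adj_linearl p : linear p -> linear (adj^~ p).
Proof.
move=> lp a x z; apply/funext => y.
rewrite /adj !fE !lsmulE !lp !lsmulE !scalerDr !scalerN; zmod.
Qed.

Lemma adj_lin x p : linear p -> linear (adj x p).
Proof.
move=> lp a y z.
rewrite /adj !lsmulE !lp !lsmulE !scalerDr !scalerN; zmod.
Qed.

Lemma adj_br x y p : linear p ->
  adj (br x y) p = adj x (adj y p) - adj y (adj x p).
Proof.
move=> lp; apply/funext => z; rewrite /adj /lsbracket !fE.
rewrite !(lsmulE, linD lp, linN lp) (lsassocl x y (p z)) (lsassocl x y z).
rewrite !(lsmulE, linD lp, linN lp).
(* The right multiplication by [z] in [adj] creates [(p y . x) . z] and [(p x . y) . z], which call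
   for left-symmetry as well. *)
rewrite (lsassocl (p y) x z) (lsassocl (p x) y z).
zmod.
Qed.

Lemma linear_comb a p q : linear p -> linear q -> linear (a *: p + q).
Proof.
move=> lp lq b x y; rewrite !fE lp lq !scalerDr !scalerA mulrC; zmod.
Qed.

(** A map of degree [k + 1] is a [k]-cochain, its last argument being carried by the values in [V];
    the three single sums of [d_def] are the three terms of [adj]. *)
Lemma d_defE k (w : multimap A k.+1) :
  d_def L w = ce br adj (w : ('I_k -> gsec A) -> V).
Proof.
apply/funext => x; apply/funext => y; rewrite /d_def /ce !fE.
have sumE (I : finType) (P : pred I) (F : I -> V) :
    (\sum_(i | P i) F i) y = \sum_(i | P i) F i y.
  exact: (big_morph (fun h : V => h y)).
rewrite !sumE -big_split -sumrB /=; congr (_ + _); apply: eq_bigr => i _.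
  by rewrite -scalerDr -scalerBr.
by rewrite sumE.
Qed.

Definition fs f p : V := fun y => fscale f (p y).

Definition symb p S :=
  forall f y, p (fscale f y) = fscale f (p y) + fscale (vact S f) y.

Lemma symb_comb a p q S X : symb p S -> symb q X -> symb (a *: p + q) (a *: S + X).
Proof.
move=> hp hq f y; rewrite !fE hp hq vact_comb fscaleDl fscaleZl fscaleDr fscaleZr.
rewrite scalerDr; zmod.
Qed.

Lemma symb0 : symb 0 0.
Proof. by move=> f y; rewrite vact0 fscale0l (lin0 (fscale_linear f)) addr0. Qed.

Lemma symbD p q S X : symb p S -> symb q X -> symb (p + q) (S + X).
Proof. by move=> hp hq; have := symb_comb 1 hp hq; rewrite !scale1r. Qed.

Lemma symb_sum (I : finType) (P : pred I) (a : I -> R) F G :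
  (forall i, P i -> symb (F i) (G i)) ->
  symb (\sum_(i | P i) a i *: F i) (\sum_(i | P i) a i *: G i).
Proof.
move=> h; elim/big_rec2: _ => [|i X p Pi hp]; first exact: symb0.
exact: symb_comb (h _ Pi) hp.
Qed.

(** The terms [S(f) (x . y)] arising from [p (f x) . y] and from [p (f (x . y))] cancel: linearity
    in [x] rests on [p] having a symbol. *)
Lemma adj_fs x f p S : symb p S -> adj (fscale f x) p = fs f (adj x p).
Proof.
move=> hp; apply/funext => y.
rewrite /fs /adj !lsmul_fscalel !hp lsmulDl !lsmul_fscalel !fscaleDr fscaleNr.
zmod.
Qed.

Lemma adj_fsr x f p : adj x (fs f p) = fs f (adj x p) + fs (vact (anc x) f) p.
Proof.
apply/funext => y; rewrite fE /fs /adj lsmul_frl lsmul_fscalel !fscaleDr fscaleNr.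
zmod.
Qed.

(** The second derivatives of [f] in [x . p (f y) - p (x . f y)] form the bracket of [anc x] with
    [S], and [p x . f y] contributes [anc (p x)]. *)
Lemma adj_symb x p S : linear p -> symb p S ->
  symb (adj x p) (vbracket (anc x) S + anc (p x)).
Proof.
move=> lp hp f y; rewrite /adj hp !lsmulDr !lsmul_frl (linD lp) !hp.
rewrite vactD vact_bracket !(fscaleDl, fscaleNl, fscaleDr, fscaleNr).
zmod.
Qed.

Lemma d_def_symb k (w : multimap A k.+1) (s : homsec A k) :
  (forall z, linear (w z)) -> is_symbol w s ->
  forall x : 'I_k.+1 -> gsec A, symb (d_def L w x) (d_def_symbol L w s x).
Proof.
move=> lw ws x; rewrite d_defE /d_def_symbol addrAC -big_split /=.
have hw z : symb (w z) (homsec_app s z) by move=> f y; exact: ws.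
under [X in symb _ (X + _)]eq_bigr => i _ do rewrite -scalerDr.
apply: symbD; first by apply: symb_sum => i _; exact: adj_symb.
(* [symb_sum] speaks of weighted sums, so the outer sum over [i] is given the weight 1. *)
have one (F : vfield M) : F = 1 *: F by rewrite scale1r.
have one' p : p = 1 *: p by rewrite scale1r.
rewrite (eq_bigr _ (fun i _ => one _)) [X in symb X _](eq_bigr _ (fun i _ => one' _)).
by apply: symb_sum => i _; apply: symb_sum => j _; exact: hw.
Qed.

(** * Linearity over functions in the first arguments *)

Local Notation C k := (('I_k -> gsec A) -> V).
Local Notation lie := (lie br adj).
Local Notation ced := (ced br adj).
Local Notation coch := (coch (fun p : V => linear p)).

Definition cfs k f (c : C k) : C k := fun x : 'I_k -> gsec A => fs f (c x).

Lemma lie_cfs k v f (c : C k) :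
  lie v (cfs f c) = cfs f (lie v c) + cfs (vact (anc v) f) c.
Proof.
elim: k c => [|k IH] c; apply/funext => y; first exact: adj_fsr.
have {}IH := congr1 (fun h => h (tailf y)) (IH (contr (y ord0) c)).
rewrite lieS [contr _ _]/(cfs f (contr (y ord0) c)) IH.
apply/funext => z; rewrite !fE /cfs /fs lieS !fE fscaleDr fscaleNr /contr consf_tail.
zmod.
Qed.

(** The Leibniz rule [d (f c) = f d c + df /\ c], with [df] taken along the anchor; the sum is the
    wedge product. *)
Lemma ced_cfs k f (c : C k) (y : 'I_k.+1 -> gsec A) z : ced (cfs f c) y z =
  fscale f (ced c y z) +
  \sum_(j < k.+1) (-1) ^+ j *: fscale (vact (anc (y j)) f) (c (omit y j) z).
Proof.
elim: k c y z => [|k IH] c y z.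
  rewrite big_ord1 expr0 scale1r !ced0E.
  exact: (congr1 (fun h : V => h z) (adj_fsr _ _ _)).
rewrite !cedS lie_cfs !fE [contr _ _]/(cfs f (contr (y ord0) c)) IH.
rewrite [in RHS]big_ord_recl expr0 scale1r fscaleDr fscaleNr.
have -> : \sum_(j < k.+1) (-1) ^+ lift ord0 j *:
    fscale (vact (anc (y (lift ord0 j))) f) (c (omit y (lift ord0 j)) z) =
  - \sum_(j < k.+1) (-1) ^+ j *: fscale (vact (anc (tailf y j)) f)
      (contr (y ord0) c (omit (tailf y) j) z).
  rewrite -sumrN; apply: eq_bigr => j _; rewrite -[lift ord0 j : nat]/j.+1.
  by rewrite exprS mulN1r scaleNr /contr -omit_consfS consf_tail.
rewrite /cfs /fs -[omit y ord0]/(tailf y); zmod.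
Qed.

(** Only the first slot is tested; [clin_slot] transports the property to the others by
    alternation. *)
Definition clin k (c : C k.+1) := forall f u (y : 'I_k -> gsec A),
  c (consf (fscale f u) y) = fs f (c (consf u y)).

Lemma clin_contr k v (c : C k.+2) : coch c -> clin c -> clin (contr v c).
Proof.
move=> h cl f u y; rewrite /contr (coch_swap _ _ _ h) cl (coch_swap v u _ h).
by apply/funext => z; rewrite /fs !fE fscaleNr.
Qed.

Lemma br_fscale f u v :
  br (fscale f u) v = fscale f (br u v) - fscale (vact (anc v) f) u.
Proof.
by rewrite /lsbracket lsmul_fscalel lsmul_frl fscaleDr fscaleNr; zmod.
Qed.

Lemma clin_br k f u v (c : C k.+1) (y : 'I_k -> gsec A) z : coch c -> clin c ->
  c (consf (br (fscale f u) v) y) z = fscale f (c (consf (br u v) y) z) -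
    fscale (vact (anc v) f) (c (consf u y) z).
Proof.
move=> [l _ _] cl; rewrite br_fscale (linB (l y)) !cl.
by rewrite !fE.
Qed.

(** The correction is [df /\ iota_u c]: each bracket [[f u, y_j]] yields one of its summands, while
    the action of [f u] on values is linear in [f] by [adj_fs]. *)
Lemma lie_fscale k f u (c : C k.+1) (y : 'I_k.+1 -> gsec A) z : coch c -> clin c ->
  (forall x : 'I_k.+1 -> gsec A, exists S, symb (c x) S) ->
  lie (fscale f u) c y z = fscale f (lie u c y z) + \sum_(j < k.+1)
    (-1) ^+ j *: fscale (vact (anc (y j)) f) (c (consf u (omit y j)) z).
Proof.
elim: k c y z => [|k IH] c y z h cl sc.
  rewrite !lieS !fE fscaleDr fscaleNr clin_br //.
  rewrite big_ord1 expr0 scale1r !lie0E /contr.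
  have [S hS] := sc (consf (y ord0) (tailf y)); rewrite (adj_fs _ _ hS).
  by rewrite -[omit y ord0]/(tailf y) /fs; zmod.
have {}IH := IH (contr (y ord0) c) (tailf y) z (coch_contr _ h)
  (clin_contr _ h cl) (fun t => sc (consf (y ord0) t)).
rewrite [lie (fscale f u) c y]lieS [lie u c y]lieS !fE fscaleDr fscaleNr.
rewrite clin_br // IH [in RHS]big_ord_recl expr0 scale1r.
have -> : \sum_(j < k.+1) (-1) ^+ lift ord0 j *:
    fscale (vact (anc (y (lift ord0 j))) f)
      (c (consf u (omit y (lift ord0 j))) z) =
  \sum_(j < k.+1) (-1) ^+ j *: fscale (vact (anc (tailf y j)) f)
      (contr (y ord0) c (consf u (omit (tailf y) j)) z).
  apply: eq_bigr => j _; rewrite -[lift ord0 j : nat]/j.+1.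
  have -> : omit y (lift ord0 j) = consf (y ord0) (omit (tailf y) j).
    by rewrite -omit_consfS consf_tail.
  rewrite exprS mulN1r scaleNr /contr (coch_swap (y ord0) _ _ h).
  by rewrite fE fscaleNr scalerN.
by rewrite -[omit y ord0]/(tailf y); zmod.
Qed.

(** In [L_(f u) c - d (f iota_u c)] both terms produce the same [df /\ iota_u c]. In degree 0 there
    is no slot to test beforehand and [adj_fs] suffices. *)
Lemma clin_ced k (c : C k) : coch c ->
  (forall x : 'I_k -> gsec A, exists S, symb (c x) S) ->
  (if k is k'.+1 return C k -> Prop then @clin k' else fun=> True) c ->
  clin (ced c).
Proof.
case: k c => [|k] c h sc cl f u y.
  rewrite !ced0E !consf0 !tailf_cons; have [S hS] := sc y.
  exact: adj_fs hS.
apply/funext => z; rewrite /fs !cedS !consf0 !tailf_cons !fE lie_fscale //.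
have -> : contr (fscale f u) c = cfs f (contr u c) by apply/funext => t; exact: cl.
rewrite ced_cfs (fscaleDr f (lie u c y z)) (fscaleNr f (ced (contr u c) y z)).
rewrite /contr; zmod.
Qed.

Lemma multider_coch k (w : multimap A k.+1) : is_multider w -> coch (w : C k).
Proof.
move=> [ml lw al _ _]; apply: multilinear_coch => [x i a u v|x i j ij xij|x].
- by apply/funext => y; exact: ml.
- by apply/funext => y; exact: al ij xij.
- exact: lw.
Qed.

Lemma d_def_ced k (w : multimap A k.+1) : is_multider w ->
  d_def L w = ced (w : C k).
Proof. by move=> hw; rewrite d_defE; apply: ceE (multider_coch hw). Qed.

Lemma coch_d_def k (w : multimap A k.+1) : is_multider w ->
  coch (d_def L w : C k.+1).
Proof.
move=> hw; rewrite d_def_ced //; apply: coch_ced (multider_coch hw).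
- exact: br_linearl.
- exact: br_linearr.
- exact: br_xx.
- exact: linear_comb.
- exact: adj_linearr.
- exact: adj_linearl.
- exact: adj_lin.
Qed.

Lemma d_def_d_def k (w : multimap A k.+1) : is_multider w ->
  d_def L (d_def L w) = 0.
Proof.
move=> hw; rewrite d_defE (ceE _ _ (coch_d_def hw)) d_def_ced //.
apply: ced_ced (multider_coch hw).
- exact: br_jacobi.
- exact: adj_linearr.
- exact: adj_br.
Qed.

Lemma d_def_linear k a (w w' : multimap A k.+1) :
  is_multider w -> is_multider w' -> is_multider (a *: w + w') ->
  d_def L (a *: w + w') = a *: d_def L w + d_def L w'.
Proof.
move=> hw hw' hc; rewrite !d_def_ced //; apply: ced_linear.
exact: adj_linearr.
Qed.

Lemma clin_slot k (c : C k.+1) (x : 'I_k.+1 -> gsec A) (i : 'I_k.+1) f :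
  coch c -> clin c -> c [eta x with i |-> fscale f (x i)] = fs f (c x).
Proof.
move=> h cl; rewrite (coch_slot i _ h) (coch_slot i x h) /= eqxx.
have -> : omit [eta x with i |-> fscale f (x i)] i = omit x i.
  by apply/funext => j; rewrite /omit /= eq_sym (negPf (neq_lift _ _)).
by rewrite cl; apply/funext => z; rewrite /fs !fE fscaleZr.
Qed.

Lemma multider_clin k (w : multimap A k.+2) : is_multider w -> clin (w : C k.+1).
Proof.
move=> hw f u y; apply/funext => z.
have := multider_fscale hw (consf u y) ord0 f z.
by rewrite consf0 upd_consf0 tailf_cons.
Qed.

Lemma clin_d_def k (w : multimap A k.+1) : is_multider w ->
  clin (d_def L w : C k.+1).
Proof.
move=> hw; rewrite d_def_ced //; apply: clin_ced.
- exact: multider_coch.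
- move=> x; have [s hs] := multider_symbol hw.
  by exists (homsec_app s x) => f y; exact: hs.
- by case: k w hw => [//|k] w hw; exact: multider_clin.
Qed.

(** The two Leibniz expansions of [f p (g y)] are compared at a point where [y] is nonzero. The case
    [f = 1] is uniqueness of the symbol. *)
Lemma symb_fs_val p S S' f (q : M) y : symb p S -> symb (fs f p) S' -> y q != 0 ->
  forall g : Cinf M, S' q g = f q * S q g.
Proof.
move=> h h' yq g; have := h' g y; rewrite /fs h fscaleDr fscaleA.
rewrite [fscale g (fscale f _)]fscaleA [g * f]mulrC => /addrI.
rewrite fscaleA => /(congr1 (fun z : gsec A => z q)) /= /eqP.
rewrite -subr_eq0 -scalerBl scaler_eq0 (negPf yq) orbF subr_eq0 => /eqP E.
exact: esym E.
Qed.

End algebroid.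

(** * Bump functions *)

Section flat_function.
Variable R : realType.
Implicit Types (t : R) (n : nat).

(* t^(-n) exp(-1/t) for t > 0: this family is closed under differentiation. *)
Definition flat n t : R := if 0 < t then t^-1 ^+ n * expR (- t^-1) else 0.

Definition dflat n t : R := flat n.+2 t - n%:R * flat n.+1 t.

Lemma flat_ge0 n t : 0 <= flat n t.
Proof.
rewrite /flat; case: ifPn => // t0.
by rewrite mulr_ge0 ?expR_ge0 // exprn_ge0 // invr_ge0 ltW.
Qed.

(** For [n > 0], this is [s <= expR s] at [s = t / n], raised to the power [n]. *)
Lemma expr_le_expR n t : 0 <= t -> t ^+ n <= n%:R ^+ n * expR t.
Proof.
case: n => [|n] t0; first by rewrite !expr0 mul1r -expR0 ler_expR.
have n0 : (n.+1%:R : R) != 0 by rewrite pnatr_eq0.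
have -> : expR t = expR (t / n.+1%:R) ^+ n.+1 by rewrite -expRM_natr divfK.
rewrite -exprMn; apply: lerXn2r; rewrite ?nnegrE ?mulr_ge0 ?expR_ge0 //.
rewrite mulrC -ler_pdivrMr ?ltr0n //.
by apply: le_trans (expR_ge1Dx _); rewrite lerDr.
Qed.

(** [expr_le_expR] at [t^-1] with exponent [n + 1]: the spare power of [t^-1] becomes the factor
    [t], which forces the limit 0 at the origin. *)
Lemma flat_le n t : 0 <= t -> flat n t <= n.+1%:R ^+ n.+1 * t.
Proof.
move=> t0; rewrite /flat; case: ifPn => [tp|_]; last by rewrite mulr_ge0 // exprn_ge0.
have h := expr_le_expR n.+1 (ltW (eq_ind_r is_true tp (invr_gt0 t))).
have tN : t != 0 by rewrite gt_eqF.
rewrite -(ler_pM2l (x := t^-1)) ?invr_gt0 //.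
rewrite mulrA -exprS mulrCA mulVf // mulr1 expRN.
by rewrite ler_pdivrMr ?expR_gt0.
Qed.

Lemma flat_continuous0 n : flat n x @[x --> (0 : R)] --> (0 : R).
Proof.
apply/cvgrPdist_le => e e0.
have C0 : 0 < n.+1%:R ^+ n.+1 :> R by rewrite exprn_gt0.
near=> x; rewrite sub0r normrN ger0_norm ?flat_ge0 //.
have [x0|x0] := leP 0 x; last by rewrite /flat ltNge (ltW x0) ltW.
apply: le_trans (flat_le n x0) _.
rewrite mulrC -ler_pdivlMr //; apply: le_trans (ler_norm x) _.
near: x; exact: (@nbhs0_le _ R _ (divr_gt0 e0 C0)).
Unshelve. all: by end_near. Qed.

Lemma is_derive_flat n t : is_derive t 1 (flat n) (dflat n t).
Proof.
have [t0|t0|->] := ltgtP t 0.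
- have -> : dflat n t = 0.
    by rewrite /dflat /flat !ltNge (ltW t0) /= mulr0 subrr.
  apply: (@near_eq_is_derive _ _ _ (cst 0)).
  near=> z; rewrite /flat ltNge; suff -> : z <= 0 by [].
  by near: z; exact: lt_le_nbhsl.
- have tN : t != 0 by rewrite gt_eqF.
  have dV : is_derive t 1 (fun z : R => z^-1) (- t ^- 2).
    apply: is_derive_eq (is_deriveV tN (is_derive_id t 1)) _.
    by rewrite /GRing.scale /= mulr1.
  have dE : is_derive t 1 (fun z : R => expR (- z^-1)) (t ^- 2 * expR (- t^-1)).
    have dN : is_derive t 1 (fun z : R => - z^-1) (t ^- 2).
      by apply: is_derive_eq (is_deriveN dV) _; rewrite opprK.
    apply: is_derive_eq (@is_derive1_comp _ _ _ _ _ _ (is_derive_expR _) dN) _.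
    by rewrite mulrC.
  have dX : is_derive t 1 (fun z : R => z^-1 ^+ n) (n%:R * t^-1 ^+ n.-1 * - t ^- 2).
    have -> : (fun z : R => z^-1 ^+ n) = (fun z : R => z^-1) ^+ n.
      by apply/funext => z; elim: n => // n IHn; rewrite !exprS IHn.
    exact: is_deriveX.
  suff dF : is_derive t 1 (fun z => z^-1 ^+ n * expR (- z^-1)) (dflat n t).
    apply: near_eq_is_derive dF; near=> z; rewrite /flat.
    by suff -> : 0 < z by []; near: z; exact: lt_nbhsr.
  apply: is_derive_eq (is_deriveM dX dE) _.
  rewrite /dflat /flat t0 /GRing.scale /= -exprVn; set e := expR _.
  case: n dX => [|n] dX; first by rewrite !mul0r mulr0 addr0 subr0 mulrA !expr0 mul1r.
  rewrite /= !exprS; set x := t^-1; set y := x ^+ n.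
  by rewrite expr0; ring.
(* At 0 the difference quotient of [flat n] is [flat n.+1], so derivability there reduces to
   [flat_continuous0]. *)
- have E h : h^-1 *: ((flat n \o shift 0) (h *: 1) - flat n 0) = flat n.+1 h.
    rewrite /= addr0 /flat ltxx subr0 /GRing.scale /= mulr1.
    by case: ifPn => h0; rewrite ?mulr0 // exprS mulrA.
  have cE : (fun h => h^-1 *: ((flat n \o shift 0) (h *: 1) - flat n 0)) @ 0^'
      --> dflat n 0.
    have -> : dflat n 0 = 0 by rewrite /dflat /flat ltxx mulr0 subrr.
    under eq_fun do rewrite E.
    exact: cvg_within_filter (@flat_continuous0 n.+1).
  split; first by apply/cvg_ex; exists (dflat n 0).
  exact: cvg_lim cE.
Unshelve. all: by end_near. Qed.

End flat_function.

Section ndiff_theory.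
Variables (R : realType) (V : normedModType R).
Implicit Types (U : set V).

Lemma ndiffU (W : normedModType R) n U U' (f : V -> W) :
  ndiff n U f -> ndiff n U' f -> ndiff n (U `|` U') f.
Proof.
elim: n f => [//|n IH] f [df ndf] [df' ndf'].
split=> [x [/df|/df'] //|v].
exact: IH (ndf v) (ndf' v).
Qed.

Lemma ndiffZ n U (a : R) (f : V -> R) : open U ->
  ndiff n U f -> ndiff n U (fun x => a * f x).
Proof. by move=> oU sf; apply: ndiffM (sf); last exact: ndiff_cst. Qed.

(** The induction is uniform in [m], because the derivative of [flat m] involves [flat m.+1] and
    [flat m.+2]. *)
Lemma ndiff_flat n m U (s : V -> R) : open U ->
  ndiff n U s -> ndiff n U (fun x => flat m (s x)).
Proof.
move=> oU; elim: n m s => [//|n IH] m s hs; have [ds nds] := hs.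
have dflat_s x : differentiable (flat m) (s x).
  by apply/derivable1_diffP; case: (is_derive_flat m (s x)).
split=> [x Ux|v]; first exact: (differentiable_comp (ds x Ux) (dflat_s x)).
have hW := ndiffW hs.
apply: (@eq_ndiff _ _ _ oU _ _
  (fun x => (flat m.+2 (s x) + - m%:R * flat m.+1 (s x)) * 'd s x v)).
  move=> x Ux; have := diff_comp (ds x Ux) (dflat_s x).
  move=> /(congr1 (fun h => h v)) /= ->.
  rewrite diff1E // derive1E; have [_ ->] := is_derive_flat m (s x).
  by rewrite mulNr mulrC.
apply: ndiffM (nds v) => //; apply: ndiffD; [by []|exact: IH|].
by apply: ndiffZ => //; exact: IH.
Qed.

Lemma row_coord_linear k (j : 'I_k) : linear (fun u : 'rV[R]_k => u 0 j : R).
Proof. by move=> a u v; rewrite !mxE. Qed.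

Lemma ndiff_coord n U k (h : V -> 'rV[R]_k) (j : 'I_k) : open U ->
  ndiff n U h -> ndiff n U (fun x => h x 0 j).
Proof.
move=> oU; elim: n h => [//|n IH] h [dh ndh].
have dc (u : 'rV[R]_k) : differentiable (fun u : 'rV[R]_k => u 0 j : R) u.
  exact: differentiable_coord.
split=> [x Ux|v]; first exact: (differentiable_comp (dh x Ux) (dc _)).
apply: (eq_ndiff oU _ (IH _ (ndh v))) => x Ux.
have /(congr1 (fun f => f v)) /= := diff_comp (dh x Ux) (dc (h x)).
move=> ->; pose cj : {linear 'rV[R]_k -> R} := HB.pack (fun u : 'rV[R]_k => u 0 j : R)
  (GRing.isLinear.Build _ _ _ _ (fun u : 'rV[R]_k => u 0 j : R) (row_coord_linear j)).
have /(congr1 (fun f => f ('d h x v))) /= :=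
  @diff_lin _ _ _ cj (h x) (@coord_continuous _ _ _ 0 j).
exact.
Qed.

Lemma ndiff_prod n U (I : finType) (F : I -> V -> R) : open U ->
  (forall i, ndiff n U (F i)) -> ndiff n U (fun x => \prod_i F i x).
Proof.
move=> oU h; elim: (index_enum I) => [|i r IH].
  by under eq_fun do rewrite big_nil; exact: ndiff_cst.
by under eq_fun do rewrite big_cons; exact: ndiffM.
Qed.

End ndiff_theory.

Section msmooth_theory.
Variables (R : realType) (M : manifold R).
Implicit Types (V W O : set M) (f g : M -> R).

Lemma eq_msmooth V f g : open V ->
  (forall q, V q -> f q = g q) -> msmooth V f -> msmooth V g.
Proof.
move=> oV fg sf i n; apply: eq_ndiff (sf i n); first exact: chart_open.
by move=> u [_ Vu] /=; exact: fg.
Qed.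

Lemma msmoothS V V' f : V' `<=` V -> msmooth V f -> msmooth V' f.
Proof. by move=> sV sf i n; apply: ndiff_sub (sf i n) => u [? /sV]. Qed.

Lemma msmoothU V V' f : msmooth V f -> msmooth V' f -> msmooth (V `|` V') f.
Proof.
move=> sf sf' i n; have := ndiffU (sf i n) (sf' i n).
by rewrite -setIUr.
Qed.

(** Extension by zero: [O] is covered by its parts in [V], where both factors are smooth, and in
    [W], where the product is 0. *)
Lemma msmooth_cut V W O (chi : M -> R) h : open V -> open W -> open O ->
  V `|` W = setT -> (forall q, W q -> chi q = 0) ->
  msmooth setT chi -> msmooth (V `&` O) h -> msmooth O (fun q => chi q * h q).
Proof.
move=> oV oW oO VW chi0 sc sh.
have -> : O = (V `&` O) `|` (W `&` O) by rewrite -setIUl VW setTI.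
apply: msmoothU.
  by apply: msmoothM sh; [exact: openI|exact: msmoothS sc].
apply: (@eq_msmooth _ (fun=> 0)); first exact: openI.
  by move=> q [Wq _]; rewrite chi0 ?mul0r.
by apply: msmooth_cst; exact: openI.
Qed.

(* A bump function in the coordinates of a chart is a product of the flat
   functions of r + (u_k - a_k) and r - (u_k - a_k): it is positive exactly on
   the open box of radius r around a. *)
Definition box_bump m (a : 'rV[R]_m) (r : R) (u : 'rV[R]_m) : R :=
  \prod_(k < m) (flat 0 (r + (u 0 k - a 0 k)) * flat 0 (r - (u 0 k - a 0 k))).

Lemma flat_gt0 t : (flat 0 t != 0 :> R) = (0 < t).
Proof.
rewrite /flat; case: ifP => _; last by rewrite eqxx.
by rewrite expr0 mul1r gt_eqF // expR_gt0.
Qed.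

Lemma box_bump_neq0 m (a : 'rV[R]_m) r u :
  box_bump a r u != 0 -> forall k, `|u 0 k - a 0 k| <= r.
Proof.
rewrite /box_bump => /prodf_neq0 h k; have := h k isT.
rewrite mulf_eq0 negb_or !flat_gt0 => /andP[h1 h2].
rewrite ler_norml; apply/andP; split; rewrite -subr_ge0 ?opprK ltW //.
by rewrite addrC.
Qed.

Lemma box_bump_center m (a : 'rV[R]_m) r : 0 < r -> box_bump a r a != 0.
Proof.
move=> r0; apply/prodf_neq0 => k _; rewrite subrr addr0 subr0.
by rewrite mulf_neq0 // flat_gt0.
Qed.

Lemma ndiff_box_bump (E : normedModType R) n (U : set E) m a r (h : E -> 'rV[R]_m) :
  open U -> ndiff n U h -> ndiff n U (fun x => box_bump a r (h x)).
Proof.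
move=> oU sh; apply: ndiff_prod => // k.
have sk := ndiff_coord k oU sh.
apply: ndiffM => //; apply: ndiff_flat => //; apply: ndiffD => //.
- exact: ndiff_cst.
- by apply: ndiffD => //; exact: ndiff_cst.
- exact: ndiff_cst.
- apply: (@eq_ndiff _ _ _ oU _ _ (fun x => -1 * (h x 0 k + - a 0 k))).
    by move=> x _; rewrite mulN1r.
  by apply: ndiffZ => //; apply: ndiffD => //; exact: ndiff_cst.
Qed.

Lemma box_compact m (a : 'rV[R]_m) r :
  compact [set u : 'rV[R]_m | forall k, `|u 0 k - a 0 k| <= r].
Proof.
have := @rV_compact R m (fun k => `[a 0 k - r, a 0 k + r]%classic)
  (fun k => @segment_compact _ _ _).
congr compact; apply/seteqP; split=> u /= h k; have := h k;
  by rewrite in_itv /= -ler_distlC distrC.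
Qed.

Lemma box_nbhs m (a : 'rV[R]_m) (U : set 'rV[R]_m) : open U -> U a ->
  exists2 r : R, 0 < r & [set u : 'rV[R]_m | forall k, `|u 0 k - a 0 k| <= r] `<=` U.
Proof.
move=> oU Ua; have /nbhs_ballP[e /= e0 he] := open_nbhs_nbhs (conj oU Ua).
(* Halving the radius fits the closed box into the open ball. *)
exists (e / 2); first exact: divr_gt0.
move=> u hu; apply: he; rewrite /ball /= /mx_ball; split=> // i k; rewrite ord1 /ball /=.
rewrite distrC; apply: le_lt_trans (hu k) _.
by rewrite ltr_pdivrMr // ltr_pMr // ltr1n.
Qed.

(** As [M] is Hausdorff, the image [K] of a compact coordinate box is closed, so a bump function in
    one chart extends by zero. The open set [W] with [V] and [W] covering [M] encodes support inside
    [V]. *)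
Lemma bump_exists (p : M) V : open V -> V p ->
  exists chi : Cinf M, exists W, [/\ open W, V `|` W = setT, chi p != 0 &
    forall q, W q -> chi q = 0].
Proof.
move=> oV Vp; have [i ip] := m_cover p.
pose a := mchart i p.
pose U := mcod i `&` minv i @^-1` V.
have oU : open U by exact: chart_open.
have Ua : U a by split; [exact: mchart_cod|rewrite /= mchartK].
have [r r0 hr] := box_nbhs oU Ua.
pose B := [set u : 'rV[R]_(mdim M) | forall k, `|u 0 k - a 0 k| <= r].
pose K := minv i @` B.
have cK : closed K.
  apply: compact_closed; first exact: m_hausdorff.
  apply: continuous_compact (@box_compact _ a r).
  apply: continuous_subspaceW (@minv_cont _ M i).
  by move=> u /hr[].
pose f q := if `[< mdom i q >] then box_bump a r (mchart i q) else 0.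
have f0 q : (~` K) q -> f q = 0.
  move=> nK; rewrite /f; case: ifPn => // /asboolP iq.
  apply/eqP; apply/negP => /negP h; apply: nK.
  by exists (mchart i q); [exact: box_bump_neq0 h|rewrite mchartK].
have sf : smooth_fun f.
  apply/asboolP => j n.
  (* In chart [j] the function is [box_bump] of a transition map over [mdom i] and 0 off [K]; these
     two open sets cover. *)
  have -> : mcod j `&` minv j @^-1` setT =
     (mcod j `&` minv j @^-1` mdom i) `|` (mcod j `&` minv j @^-1` ~` K).
    rewrite -setIUr -preimage_setU; congr (_ `&` _ @^-1` _).
    apply/seteqP; split=> // q _; have [qK|] := pselect (K q); last by right.
    by left; case: qK => u Bu <-; apply: minv_dom; case: (hr _ Bu).
  have oK : open (~` K) by exact: closed_openC.
  apply: ndiffU.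
    have o1 := @chart_open _ _ _ j (mdom_open i).
    apply: (eq_ndiff o1 _ (ndiff_box_bump a r o1 (@m_transition _ M j i n))).
    by move=> u [_ ui] /=; rewrite /f asboolT.
  have o2 := @chart_open _ _ _ j oK.
  apply: (eq_ndiff o2 _ (@ndiff_cst _ _ _ o2 _ n 0)).
  by move=> u [_ uK] /=; rewrite f0.
exists (MkCinf sf), (~` K); split => //.
- exact: closed_openC.
- apply/seteqP; split=> // q _; have [qK|] := pselect (K q); last by right.
  by left; case: qK => u Bu <-; case: (hr _ Bu).
- by rewrite /= /f asboolT // box_bump_center.
Qed.

Lemma cut_smooth V W (chi : Cinf M) h : open V -> open W ->
  V `|` W = setT -> (forall q, W q -> chi q = 0) -> msmooth V h ->
  smooth_fun (fun q => chi q * h q).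
Proof.
move=> oV oW VW chi0 sh; apply/asboolP; apply: (msmooth_cut oV oW openT VW chi0).
  by case: (chi) => c /= /asboolP.
by rewrite setIT.
Qed.

End msmooth_theory.

(** * Extension of sections and tensoriality *)

Section extension.
Variables (R : realType) (M : manifold R) (A : vbundle M).
Implicit Types (x y : gsec A) (p q : M).

(* Outside [vdom i] the value is irrelevant. *)
Definition local_sec (i : vindex A) (a : 'rV[R]_(vrank A)) : sec A :=
  fun q => xget 0 [set v : A q | vtriv i q v = a].

Lemma local_secE i a q : vdom i q -> vtriv i q (local_sec i a q) = a.
Proof.
move=> iq; rewrite /local_sec; case: xgetP => [v -> //|h].
have [g gK Kg] := vtriv_bij iq.
by have := h (g a); rewrite /= Kg.
Qed.

Lemma vtriv_inj i q : vdom i q -> injective (vtriv (v := A) i q).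
Proof. by move=> iq; exact: bij_inj (vtriv_bij iq). Qed.

(** In another trivialization the coordinates of a constant local section are combinations of
    entries of the transition matrix, smooth on the overlap. *)
Lemma cut_sec_subproof i a (chi : Cinf M) W : open W -> vdom i `|` W = setT ->
  (forall q, W q -> chi q = 0) -> is_gsec (fun q => chi q *: local_sec i a q).
Proof.
move=> oW VW chi0; apply/asboolP => j k.
have oi := @vdom_open _ _ A i; have oj := @vdom_open _ _ A j.
have -> : (fun q => vtriv j q (chi q *: local_sec i a q) 0 k) =
    (fun q => chi q * vtriv j q (local_sec i a q) 0 k).
  by apply/funext => q; rewrite linearZ mxE.
apply: (msmooth_cut oi oW oj VW chi0); first by case: (chi) => c /= /asboolP.
have [g gE sg] := @v_transition _ _ A i j.
have oij : open (vdom i `&` vdom j) by exact: openI.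
apply: (@eq_msmooth _ _ _ (fun q => \sum_s a 0 s * g q s k)) => //.
  by move=> q ijq; rewrite gE // local_secE ?mxE //; case: ijq.
move: (index_enum _) => r.
elim: r => [|s r IH].
  by under eq_fun do rewrite big_nil; exact: msmooth_cst.
under eq_fun do rewrite big_cons.
by apply: msmoothD => //; apply: msmoothM => //; exact: msmooth_cst.
Qed.

Definition cut_sec i a (chi : Cinf M) W oW VW chi0 : gsec A :=
  Gsec (@cut_sec_subproof i a chi W oW VW chi0).

Lemma gsec_extend p (v : A p) : exists x : gsec A, x p = v.
Proof.
have [i ip] := @v_cover _ _ A p.
have [chi [W [oW VW chip chi0]]] := bump_exists (@vdom_open _ _ A i) ip.
exists ((chi p)^-1 *: cut_sec (vtriv i p v) oW VW chi0).
change ((chi p)^-1 *: (chi p *: local_sec i (vtriv i p v) p) = v).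
rewrite scalerA mulVf // scale1r.
by apply: (vtriv_inj ip); rewrite local_secE.
Qed.

Lemma gsec_vanish x p : x p = 0 -> exists2 chi : Cinf M, chi p != 0 &
  exists (f : 'I_(vrank A) -> Cinf M) (e : 'I_(vrank A) -> gsec A),
    (forall k, f k p = 0) /\ fscale chi x = \sum_k fscale (f k) (e k).
Proof.
move=> xp; have [i ip] := @v_cover _ _ A p.
have oi := @vdom_open _ _ A i.
have [chi [W [oW VW chip chi0]]] := bump_exists oi ip.
have sx k : msmooth (vdom i) (fun q => vtriv i q (x q) 0 k).
  by case: x {xp} => x /= /asboolP.
pose f k := MkCinf (cut_smooth oi oW VW chi0 (sx k)).
pose e k := cut_sec (delta_mx 0 k) oW VW chi0.
(* One factor [chi] makes the coordinates of [x] global functions, the other makes the local frame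
   global. *)
exists (chi * chi); first by rewrite /= mulf_neq0.
exists f, e; split; first by move=> k; rewrite /= xp linear0 mxE mulr0.
have sumE q (F : 'I_(vrank A) -> gsec A) : (\sum_k F k) q = \sum_k F k q.
  exact: (big_morph (fun y : gsec A => y q)).
apply: gsecP => q; rewrite sumE; transitivity ((chi q * chi q) *: x q); first by [].
rewrite (eq_bigr (fun k => (chi q * vtriv i q (x q) 0 k) *:
  (chi q *: local_sec i (delta_mx 0 k) q))) //.
have : (vdom i `|` W) q by rewrite VW.
case=> [iq|Wq]; last first.
  by rewrite chi0 // mulr0 scale0r big1 // => k _; rewrite mul0r scale0r.
apply: (vtriv_inj iq); rewrite linearZ linear_sum /=.
rewrite [in LHS](row_sum_delta (vtriv i q (x q))).
rewrite scaler_sumr; apply: eq_bigr => k _.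
by rewrite !linearZ /= local_secE // !scalerA; congr (_ *: _); ring.
Qed.

End extension.

(** * From function-linear maps to tensors *)

Section tensoriality.
Variables (R : realType) (M : manifold R) (A : vbundle M).

Lemma gsec_neq0 (p : M) : (0 < vrank A)%N -> exists y : gsec A, y p != 0.
Proof.
move=> r0; have [i ip] := @v_cover _ _ A p.
have [g gK Kg] := vtriv_bij ip.
have [y yp] := gsec_extend (g (const_mx 1)).
exists y; rewrite yp; apply/eqP => /(congr1 (vtriv i p)).
rewrite Kg linear0 => /rowP/(_ (Ordinal r0)); rewrite !mxE => /eqP.
by rewrite oner_eq0.
Qed.

Lemma gsec_rank0 (x : gsec A) : vrank A = 0%N -> x = 0.
Proof.
move=> r0; apply: gsecP => p; have [i ip] := @v_cover _ _ A p.
apply: (vtriv_inj ip); apply/rowP => k; exfalso.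
by case: k => k; rewrite r0.
Qed.

Lemma upd_upd (U : Type) k (x : 'I_k -> U) (i : 'I_k) u v :
  ([eta [eta x with i |-> u] with i |-> v] : 'I_k -> U) = [eta x with i |-> v].
Proof. by apply/funext => j /=; case: eqP. Qed.

Lemma upd_id (U : Type) k (x : 'I_k -> U) (i : 'I_k) :
  ([eta x with i |-> x i] : 'I_k -> U) = x.
Proof. by apply/funext => j /=; case: eqP => // ->. Qed.

Section at_point.
Variables (p : M) (k : nat) (F : ('I_k -> gsec A) -> tvec p).
Hypothesis mF : multilinear F.
Hypothesis fF : forall (x : 'I_k -> gsec A) i (f : Cinf M),
  F [eta x with i |-> fscale f (x i)] = f p *: F x.

Lemma tensor_fscale (x : 'I_k -> gsec A) i (f : Cinf M) (u : gsec A) :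
  F [eta x with i |-> fscale f u] = f p *: F [eta x with i |-> u].
Proof.
by have := fF [eta x with i |-> u] i f; rewrite upd_upd /= eqxx.
Qed.

(** [chi(p) F(x)] is the sum of the [f_k(p) F(..., e_k, ...)], hence 0, and [chi(p)] is nonzero. *)
Lemma tensor0 (x : 'I_k -> gsec A) i : x i p = 0 -> F x = 0.
Proof.
move=> /gsec_vanish[chi chip [f [e [f0 E]]]].
have := fF x i chi; rewrite E (lin_sum (mF x i)) big1.
  by move=> /esym/eqP; rewrite scaler_eq0 (negPf chip) => /eqP.
by move=> j _; rewrite tensor_fscale f0 scale0r.
Qed.

Lemma tensor_eq (x y : 'I_k -> gsec A) : (forall i, x i p = y i p) -> F x = F y.
Proof.
(* [z m] follows [y] in the first [m] slots and [x] in the others; consecutive tuples differ in one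
   slot, by a section vanishing at [p]. *)
move=> xy; pose z m : 'I_k -> gsec A := fun i => if (i < m)%N then y i else x i.
have -> : y = z k by apply/funext => i; rewrite /z ltn_ord.
suff h m : (m <= k)%N -> F x = F (z m) by exact: h.
elim: m => [|m IH] mk; first by congr F; apply/funext.
rewrite IH ?(ltnW mk) //; pose i := Ordinal mk.
have -> : z m.+1 = [eta z m with i |-> y i].
  apply/funext => j; rewrite /z /= ltnS leq_eqVlt -(inj_eq val_inj) /=.
  by case: eqP => // jm; have -> : j = i by exact/val_inj.
rewrite -{1}(upd_id (z m) i); apply/eqP; rewrite -subr_eq0.
rewrite -(linB (mF (z m) i)); apply/eqP; apply: (@tensor0 _ i) => /=.
rewrite eqxx /z /= ltnn.
change (x i p - y i p = 0); by rewrite xy subrr.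
Qed.

End at_point.

(** The value on vectors at [p] is that of [T] on chosen extensions. The choice need not be linear,
    but [tensor_eq] makes the value independent of it. *)
Lemma homsec_of_tensor k (T : ('I_k -> gsec A) -> vfield M) :
  multilinear T -> alternating T ->
  (forall (x : 'I_k -> gsec A) i (f : Cinf M) p,
    T [eta x with i |-> fscale f (x i)] p = f p *: T x p) ->
  exists t : homsec A k, forall x, homsec_app t x = T x.
Proof.
move=> mT aT fT.
have [ext extE] : {ext : forall p, A p -> gsec A | forall p v, ext p v p = v}.
  have H p : {e : A p -> gsec A | forall v, e v p = v}.
    have h (v : A p) := cid (gsec_extend v).
    by exists (fun v => projT1 (h v)) => v; exact: (projT2 (h v)).
  by exists (fun p => projT1 (H p)) => p; exact: (projT2 (H p)).
pose F p x := T x p : tvec p.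
have mF p : multilinear (F p).
  by move=> x i a u v; rewrite /F (mT x i).
have fF p (x : 'I_k -> gsec A) i f :
  F p [eta x with i |-> fscale f (x i)] = f p *: F p x by exact: fT.
pose val p (v : 'I_k -> A p) := F p (fun i => ext p (v i)).
have ml p : multilinear (@val p).
  move=> v i a u w; rewrite /val.
  have E z : F p (fun j => ext p ([eta v with i |-> z] j)) =
      F p [eta (fun j => ext p (v j)) with i |-> ext p z].
    by congr (F p _); apply/funext => j /=; case: eqP.
  rewrite !E -(mF p _ i); apply: (tensor_eq (mF p) (@fF p)) => j /=.
  case: eqP => // _; rewrite extE.
  by change (a *: u + w = a *: ext p u p + ext p w p); rewrite !extE.
(* Equal vectors have the same chosen extension. *)
have al p : alternating (@val p).
  move=> v i j ij vij; rewrite /val /F (aT _ i j ij) //; by rewrite vij.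
have ev (x : 'I_k -> gsec A) p : val p (fun i => x i p) = T x p.
  by apply: (tensor_eq (mF p) (@fF p)) => j; rewrite extE.
have sm (x : 'I_k -> gsec A) : is_vfield (fun p => val p (fun i => x i p)).
  have -> : (fun p => val p (fun i => x i p)) = T x.
    by apply: functional_extensionality_dep => p; exact: ev.
  by case: (T x).
exists (Homsec ml al sm) => x.
by apply: vfieldP => p f; rewrite /= ev.
Qed.

End tensoriality.

(** * The complex of multiderivations *)

Section multiderivations.
Variables (R : realType) (M : manifold R) (A : vbundle M) (L : lsalgebroid A).

Lemma multilinear0 (U V : lmodType R) k (h : ('I_k -> U) -> V) x i :
  multilinear h -> x i = 0 -> h x = 0.
Proof. by move=> mh xi; have := lin0 (mh x i); rewrite -xi upd_id. Qed.

Lemma homsec_comb k a (s t : homsec A k) :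
  exists r : homsec A k, forall x, homsec_app r x = a *: homsec_app s x + homsec_app t x.
Proof.
pose val p (v : 'I_k -> A p) := a *: homsec_val s v + homsec_val t v.
have ml p : multilinear (@val p).
  move=> v i b u w; rewrite /val (homsec_multilinear s v i) (homsec_multilinear t v i).
  by rewrite !scalerDr !scalerA mulrC addrACA.
have al p : alternating (@val p).
  move=> v i j ij vij; rewrite /val.
  by rewrite (homsec_alternating s ij) // (homsec_alternating t ij) // scaler0 addr0.
have sm (x : 'I_k -> gsec A) : is_vfield (fun p => val p (fun i => x i p)).
  exact: (valP (a *: homsec_app s x + homsec_app t x)).
by exists (Homsec ml al sm) => x; apply: vfieldP.
Qed.

Lemma multider0 k : is_multider (0 : multimap A k.+1).
Proof.
split=> [y x i a u v|x a u v|y x i j|x i f y|]; rewrite ?scaler0 ?addr0 //.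
  by rewrite (lin0 (fscale_linear f)).
have [||x i f p|t tE] := @homsec_of_tensor _ _ A k (fun=> 0) => //.
- by move=> x i a u v; rewrite scaler0 addr0.
- by rewrite scaler0.
exists t => x f y; rewrite tE vact0 fscale0l addr0.
by rewrite (lin0 (fscale_linear f)).
Qed.

Lemma multider_comb k a (w w' : multimap A k.+1) :
  is_multider w -> is_multider w' -> is_multider (a *: w + w').
Proof.
move=> h h'; have [ml lw al fw [s hs]] := h; have [ml' lw' al' fw' [s' hs']] := h'.
have wE x y : (a *: w + w') x y = a *: w x y + w' x y by [].
split=> [y x i b u v|x b u v|y x i j ij xij|x i f y|].
- by rewrite !wE (ml y x i) (ml' y x i) !scalerDr !scalerA mulrC addrACA.
- by rewrite !wE lw lw' !scalerDr !scalerA mulrC addrACA.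
- by rewrite wE (al y _ _ _ ij) // (al' y _ _ _ ij) // scaler0 addr0.
- by rewrite !wE fw fw' fscaleDr fscaleZr.
- have [r rE] := homsec_comb a s s'; exists r => x f y.
  rewrite rE; apply: (@symb_comb _ _ _ a (w x) (w' x)).
    by move=> g z; exact: hs.
  by move=> g z; exact: hs'.
Qed.

Section positive_rank.
Hypothesis rank_gt0 : (0 < vrank A)%N.

Lemma symb_fs_rank p S S' f q : symb (A := A) p S -> symb (fs f p) S' ->
  forall g, S' q g = f q * S q g.
Proof.
have [y yq] := gsec_neq0 q rank_gt0.
by move=> h h'; exact: symb_fs_val h h' yq.
Qed.

Lemma symb_uniq p S S' : symb (A := A) p S -> symb p S' -> S = S'.
Proof.
move=> h h'; apply: vfieldP => q g; rewrite (@symb_fs_rank p S S' 1 q h) ?mul1r //.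
have -> : fs 1 p = p; last by [].
by apply/funext => y; apply: gsecP => r; exact: scale1r.
Qed.

Lemma d_def_has_symbol k (w : multimap A k.+1) : is_multider w ->
  exists t, is_symbol (d_def L w) t.
Proof.
move=> hw; have [s hs] := multider_symbol hw.
have sT := d_def_symb L (multider_linear hw) hs.
have ch := coch_d_def L hw.
have [|||t tE] := @homsec_of_tensor _ _ A k.+1 (d_def_symbol L w s).
- move=> x i a u v; apply: symb_uniq (sT _) _.
  rewrite (coch_multilinear ch x i).
  by apply: symb_comb; exact: sT.
- move=> x i j ij xij; apply: symb_uniq (sT _) _.
  rewrite (coch_alternating ch ij xij); exact: symb0.
- move=> x i f p; apply/val_inj/funext => g.
  (* By linearity of [d_def L w], the symbol at the modified tuple is a symbol of [f] times
     [d_def L w x]. *)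
  apply: symb_fs_rank (sT x) _ _.
  by rewrite -(clin_slot x i f ch (clin_d_def L hw)); exact: sT.
by exists t => x f y; rewrite tE; exact: sT.
Qed.

End positive_rank.

Lemma d_def_multider k (w : multimap A k.+1) :
  is_multider w -> is_multider (d_def L w).
Proof.
move=> hw; have ch := coch_d_def L hw; split.
- move=> y x i a u v.
  exact: (congr1 (fun h : gsec A -> gsec A => h y) (coch_multilinear ch x i a u v)).
- by move=> x; exact: (coch_good x ch).
- move=> y x i j ij xij.
  exact: (congr1 (fun h : gsec A -> gsec A => h y) (coch_alternating ch ij xij)).
- move=> x i f y; have := clin_slot x i f ch (clin_d_def L hw).
  exact: (congr1 (fun h : gsec A -> gsec A => h y)).
have [r0|r0] := posnP (vrank A); last exact: d_def_has_symbol.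
(* In rank 0 the Leibniz rule is an identity in a zero module, and the zero tensor serves as a
   symbol. *)
have [||x i f p|t tE] := @homsec_of_tensor _ _ A k.+1 (fun=> 0) => //.
- by move=> x i a u v; rewrite scaler0 addr0.
- by rewrite scaler0.
by exists t => x f y; rewrite [LHS]gsec_rank0 // [RHS]gsec_rank0.
Qed.

Lemma vbracket0l S : vbracket (0 : vfield M) S = 0.
Proof.
apply: vfieldP => p f.
change ((0 : vfield M) p (vact S f) - S p (vact 0 f) = 0).
rewrite vact0 (lin0 (@tvec_scalar _ _ p (S p))).
exact: subr0.
Qed.

Lemma anchor_rank0 x : vrank A = 0%N -> anchor_app L x = 0.
Proof.
move=> r0; apply: vfieldP => p f; rewrite /= (gsec_rank0 x r0).
by change (anchor L p 0 f = 0); rewrite linear0.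
Qed.

Lemma homsec_rank0 k (s : homsec A k.+1) x : vrank A = 0%N -> homsec_app s x = 0.
Proof.
move=> r0; apply: vfieldP => p f.
change (homsec_val s (fun i => x i p) f = 0).
rewrite (multilinear0 (i := ord0) (homsec_multilinear s (p := p))) //.
by rewrite (gsec_rank0 (x ord0) r0).
Qed.

(** For [k = 0] the symbol of [w] is an arbitrary vector field even in rank 0: the bracket terms
    vanish through the anchor, and the double sum has no pair [i < j]. *)
Lemma d_def_symbol_rank0 k (w : multimap A k.+1) s x : vrank A = 0%N ->
  d_def_symbol L w s x = 0.
Proof.
move=> r0; rewrite /d_def_symbol !big1 ?addr0 // => i _.
- by rewrite anchor_rank0 // scaler0.
- rewrite big1 // => j; case: k w s x i j => [|k] w s x i j ij.
    by move: ij; rewrite !ord1.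
  by rewrite homsec_rank0 // scaler0.
- by rewrite anchor_rank0 // vbracket0l scaler0.
Qed.

Lemma d_def_symbolE k (w : multimap A k.+1) s t x : is_multider w ->
  is_symbol w s -> is_symbol (d_def L w) t -> homsec_app t x = d_def_symbol L w s x.
Proof.
move=> hw hs ht; have [r0|r0] := posnP (vrank A).
  by rewrite d_def_symbol_rank0 // homsec_rank0.
apply: (symb_uniq r0 _ (d_def_symb L (multider_linear hw) hs x)).
by move=> f y; exact: ht.
Qed.

End multiderivations.

Theorem proposition6p2 (R : realType) (M : manifold R) (A : vbundle M)
    (L : lsalgebroid A) :
  (forall (n : nat) (w : multimap A n), (0 < n)%N -> is_multider w ->
    is_multider (d_def L w) /\
    (forall (s : homsec A n.-1) (t : homsec A n),
      is_symbol w s -> is_symbol (d_def L w) t ->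
      forall x : 'I_n -> gsec A, homsec_app t x = d_def_symbol L w s x) /\
    d_def L (d_def L w) = 0) /\
  is_cochain_complex (fun k => @is_multider R M A k.+1)
    (fun k => @d_def R M A L k.+1).
Proof.
split=> [[//|k] w _ hw|].
  split; first exact: d_def_multider.
  by split=> [s t hs ht x|]; [exact: d_def_symbolE|exact: d_def_d_def].
split=> k.
- exact: multider0.
- by move=> a x y; exact: multider_comb.
- by move=> x; exact: d_def_multider.
- by move=> a x y hx hy; apply: d_def_linear => //; exact: multider_comb.
- by move=> x; exact: d_def_d_def.
Qed.
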